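(* For any finitely generated infinite monoid $M$, the following relations hold between classes of dynamical $M$-systems: $$M\text{-SFT}\subsetneq M\text{-sofic}\subsetneq \tfrac{M\text{-SFT}}{\text{SFT}}=\tfrac{M\text{-sofic}}{\text{SFT}}\subsetneq \tfrac{M\text{-SFT}}{\text{sofic}}=\tfrac{M\text{-sofic}}{\text{sofic}}.$$
   Context: Let $M$ be a discrete monoid. A dynamical $M$-system is a left action of $M$ by continuous maps on a compact metrizable space. Two systems are conjugate ($\cong$) if there is an $M$-equivariant homeomorphism between them; all classes of systems in the claim are considered up to conjugacy. For a finite alphabet $\Sigma$, $M$ acts on $\Sigma^M$ (product topology) by $(mx)_n=x_{nm}$. A subshift is a topologically closed $M$-invariant subset of $\Sigma^M$. A subshift $X\subset\Sigma^M$ is an SFT if there is a clopen set $C\subset\Sigma^M$ such that $x\in X\iff \forall m\in M:\ mx\notin C$. A block map is a continuous $M$-equivariant map between subshifts; a subshift is sofic if it is the image of an SFT (possibly over another alphabet) under a block map. $M$-SFT and $M$-sofic denote the classes of SFTs and sofic shifts over $M$. We identify $(\Sigma^2)^M$ with $\Sigma^M\times\Sigma^M$. For subshifts $Y\subset\Sigma^M$ and $Z\subset(\Sigma^2)^M$ such that $Z\cap Y^2$ is an equivalence relation on $Y$, $Y/Z$ denotes the topological quotient $Y/(Z\cap Y^2)$ with the action $m[y]=[my]$. For classes of subshifts $S_1,S_2$, the class $\frac{S_1}{S_2}$ (with $M$ as the acting monoid) consists of the dynamical $M$-systems $X$ such that $X\cong Y/Z$ for some $Y\in S_1$, $Y\subset\Sigma^M$,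 and $Z\in S_2$, $Z\subset(\Sigma^2)^M$, such that $Z\cap Y^2$ is an equivalence relation on $Y$. *)

(* Defs.v *)
From HB Require Import structures.
From mathcomp Require Import all_boot all_order all_algebra generic_quotient.
From mathcomp Require Import boolp classical_sets functions cardinality filter reals topology.
Set Implicit Arguments.
Unset Strict Implicit.
Unset Printing Implicit Defensive.
Import Order.TTheory GRing.Theory Num.Theory.
Local Open Scope classical_set_scope.
Local Open Scope ring_scope.
Local Open Scope quotient_scope.

(* The acting monoid is any monoidType, with no topology: M is discrete. *)
Definition finitely_generated (M : monoidType) : Prop :=
  exists (k : nat) (g : 'I_k -> M),
    forall m : M, exists w : seq 'I_k, m = (\prod_(i <- w) g i)%g.

Definition metrizable (R : realType) (X : topologicalType) : Prop :=
  exists d : X -> X -> R,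
    [/\ forall x y, d x y = 0 <-> x = y,
        forall x y, d x y = d y x,
        forall x y z, d x z <= d x y + d y z &
        forall x, nbhs x =
          filter_from [set e : R | 0 < e] (fun e => [set y | d x y < e])].

(* A left action of M by continuous maps, on an arbitrary topological space. *)
Record mspace (M : monoidType) := MSpace {
  mcarrier :> topologicalType;
  mact : M -> mcarrier -> mcarrier;
  mact1 : forall x, mact 1%g x = x;
  mactM : forall m n x, mact (m * n)%g x = mact m (mact n x);
  mact_continuous : forall m, continuous (mact m)
}.

Record dynsys (R : realType) (M : monoidType) := DynSys {
  dynsys_space :> mspace M;
  dynsys_compact : compact [set: dynsys_space];
  dynsys_metrizable : metrizable R dynsys_space
}.

Definition equivariant (M : monoidType) (X Y : mspace M) (f : X -> Y) : Prop :=
  forall m x, f (mact m x) = mact m (f x).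

Definition conjugate (M : monoidType) (X Y : mspace M) : Prop :=
  exists (f : X -> Y) (g : Y -> X),
    [/\ cancel f g, cancel g f, continuous f, continuous g & equivariant f].

Definition config (M : monoidType) (S : finType) :=
  {ptws M -> discrete_topology S}.

Definition shift (M : monoidType) (S : finType) (m : M) (x : config M S) :
  config M S := fun n => x (n * m)%g.

Record subshift (M : monoidType) (S : finType) := Subshift {
  subshift_set :> set (config M S);
  subshift_closed : closed subshift_set;
  subshift_shift : forall m x, subshift_set x -> subshift_set (shift m x)
}.

Section SubshiftSpace.
Variables (M : monoidType) (S : finType) (Y : subshift M S).

Lemma shift1 (x : config M S) : shift 1%g x = x.
Proof. by apply/funext => n; rewrite /shift mulg1. Qed.

Lemma shiftM (m n : M) (x : config M S) :
  shift (m * n)%g x = shift m (shift n x).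
Proof. by apply/funext => k; rewrite /shift mulgA. Qed.

Lemma shift_continuous (m : M) : continuous (@shift M S m).
Proof.
move=> x; have FF : Filter (@shift M S m @ nbhs x) by exact: fmap_filter.
apply/cvg_sup => n U [V [[B oB <-]] Bx BU].
have /cvg_sup xP : nbhs x --> x by exact: cvg_id.
apply: (xP (n * m)%g); exists ((fun f : config M S => f (n * m)%g) @^-1` B).
by split => //; [exists B|move=> y By; apply: BU].
Qed.

Definition subshift_act (m : M) (y : Y) : Y :=
  exist _ (shift m (val y)) (mem_set (subshift_shift m (set_mem (valP y)))).

Lemma subshift_act1 (y : Y) : subshift_act 1%g y = y.
Proof. by apply/val_inj; rewrite /= shift1. Qed.

Lemma subshift_actM (m n : M) (y : Y) :
  subshift_act (m * n)%g y = subshift_act m (subshift_act n y).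
Proof. by apply/val_inj; rewrite /= shiftM. Qed.

Lemma subshift_act_continuous (m : M) : continuous (subshift_act m).
Proof.
apply: continuous_comp_initial => y.
apply: (@continuous_comp _ _ _ set_val (@shift M S m)).
  exact: initial_continuous.
exact: shift_continuous.
Qed.

Definition subshift_space : mspace M :=
  MSpace subshift_act1 subshift_actM subshift_act_continuous.

Definition is_SFT : Prop :=
  exists2 C : set (config M S),
    clopen C & forall x, subshift_set Y x <-> forall m, ~ C (shift m x).

End SubshiftSpace.

Definition block_map (M : monoidType) (S T : finType)
    (X : subshift M S) (Y : subshift M T)
    (f : subshift_space X -> subshift_space Y) : Prop :=
  continuous f /\ equivariant f.

Definition is_sofic (M : monoidType) (S : finType) (Y : subshift M S) : Prop :=
  exists (T : finType) (X : subshift M T)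
    (f : subshift_space X -> subshift_space Y),
    [/\ is_SFT X, block_map f & range f = [set: Y]].

(* The identification of S^M x S^M with (S^2)^M. *)
Definition config_pair (M : monoidType) (S : finType) (x y : config M S) :
  config M (S * S)%type := fun n => (x n, y n).

Section QuotientSpace.
Variables (M : monoidType) (S : finType).
Variables (Y : subshift M S) (Z : subshift M (S * S)%type).

(* The trace of Z on Y, as a relation on the points of Y. *)
Definition quot_rel : rel Y :=
  fun x y => `[< subshift_set Z (config_pair (val x) (val y)) >].

Definition quot_equiv : Prop :=
  [/\ reflexive quot_rel, symmetric quot_rel & transitive quot_rel].

Hypothesis E : quot_equiv.

Definition quot_equiv_rel : equiv_rel Y :=
  EquivRel quot_rel (let: And3 r _ _ := E in r) (let: And3 _ s _ := E in s)
    (let: And3 _ _ t := E in t).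

Definition quot_carrier : topologicalType :=
  quotient_topology {eq_quot quot_equiv_rel}.

Definition quot_pi (y : Y) : quot_carrier := \pi_({eq_quot quot_equiv_rel}) y.

Lemma quot_piP (x y : Y) : quot_pi x = quot_pi y <-> quot_rel x y.
Proof. by split=> /(@eqmodP _ quot_equiv_rel). Qed.

Definition quot_act (m : M) (q : quot_carrier) : quot_carrier :=
  quot_pi (subshift_act m (repr q)).

Lemma quot_act_pi (m : M) (y : Y) :
  quot_act m (quot_pi y) = quot_pi (subshift_act m y).
Proof.
apply/quot_piP/asboolP.
have /quot_piP/asboolP Zy : quot_pi (repr (quot_pi y)) = quot_pi y.
  exact: reprK.
exact: (subshift_shift m Zy).
Qed.

Lemma quot_act1 (q : quot_carrier) : quot_act 1%g q = q.
Proof. by rewrite /quot_act subshift_act1; exact: reprK. Qed.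

Lemma quot_actM (m n : M) (q : quot_carrier) :
  quot_act (m * n)%g q = quot_act m (quot_act n q).
Proof. by rewrite {3}/quot_act quot_act_pi /quot_act subshift_actM. Qed.

Lemma quot_act_continuous (m : M) : continuous (quot_act m).
Proof.
apply/quotient_continuous.
have -> : quot_act m \o \pi_quot_carrier = quot_pi \o subshift_act m.
  by apply/funext => y; exact: quot_act_pi.
move=> y; apply: continuous_comp; first exact: subshift_act_continuous.
exact: pi_continuous.
Qed.

Definition quotient_space : mspace M :=
  MSpace quot_act1 quot_actM quot_act_continuous.

End QuotientSpace.

Definition subshift_class (M : monoidType) :=
  forall S : finType, set (subshift M S).

Definition SFT (M : monoidType) : subshift_class M :=
  fun S => [set Y | is_SFT Y].
Definition sofic (M : monoidType) : subshift_class M :=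
  fun S => [set Y | is_sofic Y].

(* Classes of systems are predicates rather than elements of set _: dynsys R M
   is too large a type for set. *)
Definition system_class (R : realType) (M : monoidType) := dynsys R M -> Prop.

Definition subclass (R : realType) (M : monoidType)
    (A B : system_class R M) : Prop :=
  forall X, A X -> B X.

Definition proper_subclass (R : realType) (M : monoidType)
    (A B : system_class R M) : Prop :=
  subclass A B /\ ~ subclass B A.

Definition same_class (R : realType) (M : monoidType)
    (A B : system_class R M) : Prop :=
  subclass A B /\ subclass B A.

(* The systems conjugate to a subshift of the class C. *)
Definition systems_of (R : realType) (M : monoidType) (C : subshift_class M) :
    system_class R M :=
  fun X => exists (S : finType) (Y : subshift M S),
    C S Y /\ conjugate X (subshift_space Y).

Definition quotient_systems (R : realType) (M : monoidType)
    (C1 C2 : subshift_class M) : system_class R M :=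
  fun X => exists (S : finType) (Y : subshift M S)
    (Z : subshift M (S * S)%type) (E : quot_equiv Y Z),
    [/\ C1 S Y, C2 (S * S)%type Z & conjugate X (quotient_space E)].

Arguments SFT M S _ : clear implicits.
Arguments sofic M S _ : clear implicits.
Arguments systems_of R {M} C _.
Arguments quotient_systems R {M} C1 C2 _.

(* Main.v *)
Require Import Defs.
From HB Require Import structures.
From mathcomp Require Import all_boot all_order all_algebra.
From mathcomp Require Import boolp classical_sets functions cardinality reals.
From mathcomp Require Import topology.
From mathcomp Require Import generic_quotient filter interval_inference.
From mathcomp Require Import normedtype sequences zify lra.
(* so that [shift] denotes the shift action *)
Import Defs.
Local Open Scope classical_set_scope.

(** The inclusions and equalities rest on three facts.  A block map between
    subshifts extends to the full shifts ([block_map_extends]), so SFTs and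
    sofic shifts pull back along block maps ([preimage_SFT],
    [preimage_sofic]).  A continuous equivariant surjection from a subshift to
    a Hausdorff system identifies its target with the quotient by its kernel
    ([quotient_conjugate]); hence if [Y] is the image of an SFT [X], then [Y/Z]
    is also the quotient of [X] by the pullback of [Z]
    ([quotient_pullback]).  Finally a subshift is its own quotient by the
    diagonal, which is an SFT ([subshift_is_quotient]).

    The separating examples all live along a ray: in an infinite monoid
    generated by finitely many [g i] there are distinct elements
    [1 = c 0, c 1, c 2, ...] with [c n.+1 = g (s n) * c n]
    ([infinite_ray]).  Letters carry pointers, a pointer [i] at [n] leading from
    [n] to [g i * n], so that a configuration can draw part of the ray although
    [M] has no other structure to rely on.

    - A sofic relation which is not an SFT.  On the full shift of letters
      (pointer, visibility flag, bit), two configurations are related when they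
      have the same pointers and flags and their bits differ by some function
      [h] on the visible sites, where [h] is constant along pointers.  This is an
      equivalence relation, and sofic because [h] can be carried by a hidden
      bit.  On a path drawn along the ray, whose two ends only are visible and
      where the bits differ at the far end only, no [h] exists; but a finite
      window that misses a site of the path cannot see this
      ([link_relation_not_SFT]).  As being an SFT is a conjugacy invariant
      ([conjugate_SFT]), this relation, seen as a subshift, separates sofic
      shifts from SFTs.

    - The quotient of the full shift by that relation is not a quotient by
      an SFT relation: quotients by SFT relations are expansive, and an
      expansive quotient of a full shift is a quotient by an SFT
      ([conjugate_quotient_SFT]).

    - A quotient by an SFT which is not a subshift.  Letters are now blank or
      carry a pointer and a binary digit, and two configurations are identified
      when they have the same pointers and, at each site, the binary numbers
      read along the pointers are equal modulo one.  The difference of the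
      two numbers is a carry with values in [-1, 0, 1], determined by two
      consecutive pairs of digits, so this relation is an SFT
      ([carry_relation]).  The expansions [w01111...] and [w10000...] are
      identified, so that a function of finitely many letters that is invariant
      under the relation takes a single value on all the digit sequences along
      the ray ([ray_config_constant]); in a subshift such functions would
      separate points.

    A quotient of a subshift is a dynamical system in the sense of the statement
    only if it is metrizable.  This holds because the quotient map is
    closed and [M] is countable: the images of the countably many clopen sets of
    the subshift provide countably many Urysohn functions that separate the
    points of the quotient ([closed_image_metrizable]). *)

Set Implicit Arguments.
Unset Strict Implicit.
Unset Printing Implicit Defensive.
Import Order.TTheory GRing.Theory Num.Theory.
Local Open Scope quotient_scope.

(** * The topology of full shifts *)

Section ConfigTopology.
Variables (M : monoidType) (S : finType).
Implicit Types (x y z : config M S) (F : seq M) (C : set (config M S)).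

(** Two configurations agree on the finite window [F]. *)
Definition agree F x y : Prop := forall n, n \in F -> x n = y n.

Lemma agree_sym F x y : agree F x y -> agree F y x.
Proof. by move=> xy n nF; rewrite xy. Qed.

Lemma agree_trans F x y z : agree F x y -> agree F y z -> agree F x z.
Proof. by move=> xy yz n nF; rewrite xy // yz. Qed.

Lemma agree_sub F F' x y : {subset F <= F'} -> agree F' x y -> agree F x y.
Proof. by move=> FF' xy n /FF' /xy. Qed.

Lemma eval_continuous (n : M) : continuous (fun x : config M S => x n).
Proof. exact: (@proj_continuous _ (fun=> discrete_topology S) n). Qed.

Lemma letter_clopen (n : M) (P : set S) : clopen [set x : config M S | P (x n)].
Proof.
apply: (@preimage_clopen _ _ (fun x : config M S => x n) P).
  split; first exact: discrete_open.
  exact: discrete_closed.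
exact: eval_continuous.
Qed.

Lemma agree_nbhs F x : nbhs x (agree F x).
Proof.
elim: F => [|n F IH]; first by apply: filterS filterT => y _ n.
have : nbhs x ([set y : config M S | [set x n] (y n)] `&` agree F x).
  apply: filterI => //; apply: (@open_nbhs_nbhs (config M S)); split => //.
  by case: (letter_clopen n [set x n]).
by apply: filterS => y [/= yn xy] m; rewrite inE => /predU1P[->//|/xy].
Qed.

Lemma nbhs_window x (U : set (config M S)) :
  nbhs x U -> exists F, agree F x `<=` U.
Proof.
move=> xU.
pose N := filter_from [set: seq M] (fun F => agree F x).
have FN : Filter N.
  apply: filter_from_filter; first by exists [::].
  move=> F G _ _; exists (F ++ G) => // y xy.
  by split; apply: agree_sub xy => n nF; rewrite mem_cat nF ?orbT.
have : N --> x.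
  apply/cvg_sup => n V [W [[B oB <-]] Bx BV].
  exists [:: n] => // y xy; apply: BV; rewrite /= -xy ?inE //.
by move=> /(_ U xU)[F _ FU]; exists F.
Qed.

Lemma config_hausdorff : hausdorff_space (config M S).
Proof.
apply: (@hausdorff_product M (fun=> discrete_topology S)) => n.
exact: discrete_hausdorff.
Qed.

Lemma config_compact : compact [set: config M S].
Proof.
have cS : compact [set: discrete_topology S].
  exact: (@finite_compact (discrete_topology S) setT (@finite_finset S setT)).
have := @tychonoff M (fun=> discrete_topology S) (fun=> setT) (fun=> cS).
by congr (compact _); apply/seteqP; split.
Qed.

Lemma closed_config_compact C : closed C -> compact C.
Proof. by move=> cC; apply: subclosed_compact cC config_compact _. Qed.

(** By compactness, one window serves all the points of a closed set. *)
Lemma uniform_window (K U : set (config M S)) : closed K -> open U -> K `<=` U ->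
  exists F, forall x y, K x -> agree F x y -> U y.
Proof.
move=> cK oU KU.
(* The filter of large windows. *)
pose N := filter_from [set: seq M] (fun F => [set G : seq M | {subset F <= G}]).
have FN : Filter N.
  apply: filter_from_filter; first by exists [::].
  move=> F G _ _; exists (F ++ G) => // H /= FGH.
  by split=> n nF; apply: FGH; rewrite mem_cat nF ?orbT.
have /compact_near_coveringP/(_ _ N (fun G x => agree G x `<=` U)) :=
  closed_config_compact cK.
case=> //.
  move=> x Kx.
  have [F FU] := nbhs_window (open_nbhs_nbhs (conj oU (KU _ Kx))).
  exists (agree F x, [set G : seq M | {subset F <= G}]) => /=.
    by split; [exact: agree_nbhs | exists F].
  move=> [y G] [/= xy FG] z yz; apply: FU.
  by apply: agree_trans xy _; apply: agree_sub yz.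
by move=> F _ /(_ F (fun _ => id)) FU; exists F => x y /FU; apply.
Qed.

Lemma window_clopen F C : (forall x y, agree F x y -> C x -> C y) -> clopen C.
Proof.
have oW D : (forall x y, agree F x y -> D x -> D y) -> open D.
  move=> DF; rewrite openE => x Dx; apply: filterS (agree_nbhs F x) => y xy.
  exact: DF xy Dx.
move=> CF; split; first exact: oW.
rewrite -openC; apply: oW => x y xy nCx Cy; apply: nCx.
by apply: CF Cy; exact: agree_sym.
Qed.

Lemma clopen_window C : clopen C ->
  exists F, forall x y, agree F x y -> C x -> C y.
Proof.
case=> oC cC; have [F FC] := uniform_window cC oC (fun _ => id).
by exists F => x y xy /FC; apply.
Qed.

Lemma closed_open_clopen (K U : set (config M S)) :
  closed K -> open U -> K `<=` U -> exists C, [/\ clopen C, K `<=` C & C `<=` U].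
Proof.
move=> cK oU KU; have [F FU] := uniform_window cK oU KU.
exists [set y | exists2 x, K x & agree F x y]; split.
- apply: (@window_clopen F) => x y xy [z Kz zx]; exists z => //.
  exact: agree_trans zx xy.
- by move=> x Kx; exists x.
- by move=> y [x /FU]; apply.
Qed.

Lemma to_config_continuous (X : topologicalType) (f : X -> config M S) :
  (forall n s, open [set x | f x n = s]) -> continuous f.
Proof.
move=> of_ x U fxU; have [F FU] := nbhs_window fxU.
suff : nbhs x [set y | agree F (f x) (f y)] by apply: filterS => y /FU.
elim: F {FU} => [|n F IH]; first by apply: filterS filterT => y _ n.
have : nbhs x ([set y | f y n = f x n] `&` [set y | agree F (f x) (f y)]).
  by apply: filterI => //; apply: open_nbhs_nbhs; split => //; exact: of_.
by apply: filterS => y [/= yn xy] m; rewrite inE => /predU1P[->//|/xy].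
Qed.

End ConfigTopology.

(** * Subshifts, block maps, SFTs and sofic shifts *)

Lemma compact_set_type (T : topologicalType) (A : set T) :
  compact A -> compact [set: A].
Proof.
move=> cA F PF _.
have PG : ProperFilter (val @ F : set_system T) by exact: fmap_proper_filter.
have GA : (val @ F : set_system T) A.
  by apply: (@filterS _ F _ setT); [move=> y _; exact: set_mem (valP y) | exact: filterT].
have [p [Ap cp]] := cA _ PG GA.
exists (exist _ p (mem_set Ap)); split => //.
move=> B U FB [_ [[V oV <-] /= Vp VU]].
have GB : (val @ F : set_system T) (val @` B).
  by apply: (@filterS _ F _ B) => // y By; exists y.
have [_ [[y By <-] Vy]] := cp _ _ GB (open_nbhs_nbhs (conj oV Vp)).
by exists y; split => //; exact: VU.
Qed.

Section Subshifts.
Variables (M : monoidType) (S : finType).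

Lemma subshift_valP (X : subshift M S) (x : X) : subshift_set X (val x).
Proof. exact: set_mem (valP x). Qed.

Lemma subshift_compact (X : subshift M S) : compact [set: subshift_space X].
Proof.
exact: (compact_set_type (closed_config_compact (@subshift_closed _ _ X))).
Qed.

Lemma subshift_val_continuous (X : subshift M S) :
  continuous (val : subshift_space X -> config M S).
Proof. exact: initial_continuous. Qed.

Lemma subshift_hausdorff (X : subshift M S) : hausdorff_space (subshift_space X).
Proof.
rewrite open_hausdorff => x y xy.
have vxy : val x != val y :> config M S by rewrite (inj_eq val_inj).
have := @config_hausdorff M S; rewrite open_hausdorff => /(_ _ _ vxy).
case=> -[/= U V] /= [xU yV] [oU oV UV].
exists (val @^-1` U, val @^-1` V) => /=.
  by split; apply/mem_set; [move/set_mem: xU | move/set_mem: yV].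
split; [by exists U | by exists V |].
apply/eqP/seteqP; split => // z [/= Uz Vz].
by have : (U `&` V) (val z) by []; rewrite (eqP UV).
Qed.

(** Closed sets of a subshift are separated from their neighbourhoods by clopen
    sets of the ambient full shift. *)
Lemma subshift_separation (X : subshift M S) (A B : set (subshift_space X)) :
  closed A -> open B -> A `<=` B ->
  exists C : set (config M S),
    [/\ clopen C, forall x : X, A x -> C (val x) & forall x : X, C (val x) -> B x].
Proof.
move=> cA [U oU <-] AB.
have cvA : closed (val @` A : set (config M S)).
  apply: compact_closed; first exact: config_hausdorff.
  apply: continuous_compact.
    by apply: continuous_subspaceT; exact: subshift_val_continuous.
  exact: subclosed_compact cA (@subshift_compact X) _.
have [|C [clC AC CU]] := closed_open_clopen cvA oU.
  by move=> _ [x /AB Ux <-].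
by exists C; split => // x; [move=> Ax; apply: AC; exists x | move=> /CU].
Qed.

(** The subshift of finite type defined by the forbidden clopen set [C]. *)
Definition sft_set (C : set (config M S)) : set (config M S) :=
  [set x | forall m, ~ C (shift m x)].

Lemma sft_closed C : clopen C -> closed (sft_set C).
Proof.
move=> [oC _].
have -> : sft_set C = \bigcap_(m in [set: M]) (shift m @^-1` (~` C)).
  by apply/seteqP; split => x xC m; [move=> _; apply: xC | apply: xC].
apply: closed_bigI => m _; apply: preimage_closed; last exact: open_closedC.
by move=> x _; exact: shift_continuous.
Qed.

Lemma sft_shift C m x : sft_set C x -> sft_set C (shift m x).
Proof. by move=> xC n; rewrite -shiftM. Qed.

Definition sft C (hC : clopen C) : subshift M S :=
  Subshift (sft_closed hC) (@sft_shift C).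

Lemma sft_is_SFT C (hC : clopen C) : is_SFT (sft hC).
Proof. by exists C. Qed.

End Subshifts.

Section Codes.
Variable M : monoidType.

(** Block maps between full shifts: continuous maps that commute with the
    shifts. *)
Definition code (S T : finType) (f : config M S -> config M T) : Prop :=
  continuous f /\ forall m x, f (shift m x) = shift m (f x).

Lemma code_comp (S T U : finType) (f : config M S -> config M T)
  (g : config M T -> config M U) : code f -> code g -> code (g \o f).
Proof.
move=> [cf ef] [cg eg]; split; last by move=> m x; rewrite /= ef eg.
by move=> x; apply: continuous_comp; [exact: cf | exact: cg].
Qed.

(** A local rule, applied at each site. *)
Lemma rule_code (S T : finType) (F : seq M) (r : config M S -> T) :
    (forall x y, agree F x y -> r x = r y) ->
  code (fun x n => r (shift n x) : discrete_topology T).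
Proof.
move=> rF; split; last first.
  by move=> m x; apply/funext => n; rewrite -shiftM.
apply: to_config_continuous => n s.
have [oC _] : clopen [set x : config M S | r x = s].
  by apply: (@window_clopen _ _ F) => x y /rF/= ->.
apply: (@open_comp _ _ (@shift M S n) [set x | r x = s]) => // x _.
exact: shift_continuous.
Qed.

(** The block map that applies a letter map at each site. *)
Definition relabel (S T : finType) (h : S -> T) : config M S -> config M T :=
  fun x n => h (x n).

Lemma relabel_code (S T : finType) (h : S -> T) : code (relabel h).
Proof.
have -> : relabel h = (fun x n => h (shift n x 1%g)).
  by apply/funext => x; apply/funext => n; rewrite /shift mul1g.
by apply: (@rule_code _ _ [:: 1%g] (fun x => h (x 1%g))) => x y ->; rewrite ?inE.
Qed.

Section Image.
Variables (S T : finType) (f : config M S -> config M T) (cf : code f).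

Lemma image_closed (X : subshift M S) : closed (f @` X).
Proof.
apply: compact_closed; first exact: config_hausdorff.
apply: continuous_compact; last exact/closed_config_compact/subshift_closed.
by apply: continuous_subspaceT => x; case: cf => + _; exact.
Qed.

Lemma image_shift (X : subshift M S) m y : (f @` X) y -> (f @` X) (shift m y).
Proof.
case=> x Xx <-; exists (shift m x); first exact: subshift_shift.
by case: cf.
Qed.

Definition image_subshift (X : subshift M S) : subshift M T :=
  Subshift (@image_closed X) (@image_shift X).

Lemma preimage_subshift_closed (X : subshift M T) : closed (f @^-1` X).
Proof.
apply: preimage_closed; last exact: subshift_closed.
by move=> x _; case: cf => + _; exact.
Qed.

Lemma preimage_subshift_shift (X : subshift M T) m x :
  (f @^-1` X) x -> (f @^-1` X) (shift m x).
Proof. by case: cf => _ ef Xx; rewrite /= ef; exact: subshift_shift. Qed.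

Definition preimage_subshift (X : subshift M T) : subshift M S :=
  Subshift (@preimage_subshift_closed X) (@preimage_subshift_shift X).

Lemma preimage_SFT (X : subshift M T) : is_SFT X -> is_SFT (preimage_subshift X).
Proof.
case=> C clC XC; case: cf => cf' ef; exists (f @^-1` C).
  exact: preimage_clopen.
by move=> x; rewrite /= XC; split=> + m => /(_ m); rewrite /= ef.
Qed.

End Image.

(** Block maps between subshifts extend to the full shifts.  The domain must be
    nonempty: otherwise the target alphabet may be empty and the source one
    not. *)
Lemma block_map_extends (S T : finType) (X : subshift M S) (Y : subshift M T)
    (f : subshift_space X -> subshift_space Y) : block_map f -> X !=set0 ->
  exists2 g, code g & forall x : X, val (f x) = g (val x).
Proof.
move=> [cf ef] [w0 Xw0]; pose x0 : X := exist _ w0 (mem_set Xw0).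
have sep t : exists F : seq M, forall x y : X, agree F (val x) (val y) ->
    val (f x) 1%g = t -> val (f y) 1%g = t.
  have [oA cA] : clopen [set x : subshift_space X | val (f x) 1%g = t].
    apply: (@preimage_clopen _ _ (val \o f) [set z : config M T | z 1%g = t]).
      exact: (letter_clopen 1%g [set t]).
    move=> x; apply: continuous_comp; first exact: cf.
    exact: subshift_val_continuous.
  have [C [clC AC CB]] := subshift_separation cA oA (fun _ => id).
  have [F FC] := clopen_window clC.
  by exists F => x y xy fx; apply: CB; apply: FC xy _; exact: AC.
have [F FP] := choice sep.
pose G := flatten [seq F t | t <- enum T].
have GP (x y : X) : agree G (val x) (val y) -> val (f y) 1%g = val (f x) 1%g.
  move=> xy; apply: FP (erefl _); apply: agree_sub xy => n nF.
  by apply/flatten_mapP; exists (val (f x) 1%g) => //; rewrite mem_enum.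
(* A window that matches no point of [X] gets the value of an arbitrary point. *)
pose r (z : config M S) : T :=
  val (f (xget x0 [set x : X | agree G (val x) z])) 1%g.
exists (fun z n => r (shift n z)).
  apply: (@rule_code _ _ G) => z z' zz'; rewrite /r.
  congr (val (f (xget _ _)) _); apply/seteqP; split=> x /= xz.
    exact: agree_trans xz zz'.
  exact: agree_trans xz (agree_sym zz').
move=> x; apply/funext => n.
have -> : val (f x) n = val (f (subshift_act n x)) 1%g.
  by rewrite (ef n x) /= /shift mul1g.
rewrite /r; case: xgetP => [y _ /= yx|/(_ (subshift_act n x))]; last by case.
exact: GP.
Qed.

(** Sofic shifts are the images of SFTs under block maps defined on the whole
    full shift. *)
Lemma is_soficP (S : finType) (Y : subshift M S) : is_sofic Y <->
  exists (T : finType) (X : subshift M T) (f : config M T -> config M S),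
    [/\ is_SFT X, code f & f @` X = Y].
Proof.
split=> [[T [X [f [sX bf rf]]]]|[T [X [f [sX cf fX]]]]].
  have [XN|/set0P X0] := eqVneq (X : set (config M T)) set0.
    have YN y : ~ subshift_set Y y.
      move=> Yy; have : [set: Y] (exist _ y (mem_set Yy)) by [].
      rewrite -rf => -[x _ _]; have := subshift_valP x.
      by move: (val x) => w; rewrite XN.
    (* An empty shift is the SFT that forbids everything. *)
    exists S, Y, id; split; last by rewrite image_id.
      by exists setT; [exact: clopenT | move=> x; split => [/YN//|/(_ 1%g)[]]].
    by split=> // x; exact: cvg_id.
  have [g cg fg] := block_map_extends bf X0.
  exists T, X, g; split=> //; apply/seteqP; split=> y.
    move=> [x Xx <-]; have := fg (exist _ x (mem_set Xx)); rewrite /= => <-.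
    exact: subshift_valP.
  move=> Yy; have : [set: Y] (exist _ y (mem_set Yy)) by [].
  rewrite -rf => -[x _ fx]; exists (val x); first exact: subshift_valP.
  by rewrite -fg fx.
have fXY (x : X) : f (val x) \in (Y : set (config M S)).
  by apply/mem_set; rewrite -fX; exists (val x) => //; exact: subshift_valP.
exists T, X, (fun x => exist _ (f (val x)) (fXY x)); split=> //; last first.
  apply/seteqP; split=> // y _; have := subshift_valP y; rewrite -{1}fX => -[x Xx xy].
  by exists (exist _ x (mem_set Xx)) => //; exact: val_inj.
split; last by move=> m x; apply: val_inj; case: cf => _ ef; exact: ef.
apply: continuous_comp_initial => x.
apply: (@continuous_comp _ _ _ set_val f); first exact: initial_continuous.
by case: cf => + _; exact.
Qed.

Lemma SFT_sofic (S : finType) (Y : subshift M S) : is_SFT Y -> is_sofic Y.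
Proof.
move=> sY; apply/is_soficP; exists S, Y, id; split=> //; last exact: image_id.
by split=> // x; exact: cvg_id.
Qed.

Lemma coincidence_clopen (S T : finType) (f g : config M S -> config M T) :
  code f -> code g -> clopen [set x | f x 1%g <> g x 1%g].
Proof.
move=> [cf _] [cg _].
suff : clopen [set x | f x 1%g = g x 1%g] by exact: (@clopenC _ _ setT).
have -> : [set x | f x 1%g = g x 1%g] =
    \bigcup_(t in [set: T]) [set x | f x 1%g = t /\ g x 1%g = t].
  apply/seteqP; split=> [x /= fg|x [t _ [/= -> ->]]//].
  by exists (g x 1%g).
have cl (h : config M S -> config M T) t : continuous h ->
    clopen [set x | h x 1%g = t].
  by move=> ch; apply: preimage_clopen (letter_clopen 1%g [set t]) ch.
split.
  by apply: bigcup_open => t _; apply: openI; case: (cl _ t cf); case: (cl _ t cg).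
by apply: closed_bigcup => [|t _]; [exact: finite_finset|
  apply: closedI; case: (cl _ t cf); case: (cl _ t cg)].
Qed.

(** The pullback of a sofic shift is covered by the fibre product of [f] with the
    cover. *)
Lemma preimage_sofic (S T : finType) (f : config M S -> config M T)
  (cf : code f) (Z : subshift M T) : is_sofic Z -> is_sofic (preimage_subshift cf Z).
Proof.
move=> /is_soficP[U [X [g [[C clC XC] cg gX]]]]; apply/is_soficP.
have c1 := relabel_code (@fst S U); have c2 := relabel_code (@snd S U).
have cl1 := coincidence_clopen (code_comp c1 cf) (code_comp c2 cg).
have cl2 : clopen (relabel snd @^-1` C : set (config M (S * U)%type)).
  by apply: preimage_clopen clC _; case: c2.
exists (S * U)%type, (sft (clopenU cl1 cl2)), (relabel fst); split=> //.
  exact: sft_is_SFT.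
have eqc x : (forall m, f (relabel fst (shift m x)) 1%g = g (relabel snd (shift m x)) 1%g)
     <-> f (relabel fst x) = g (relabel snd x).
  case: c1 => _ e1; case: c2 => _ e2; case: cf => _ ef; case: cg => _ eg.
  split=> [xm|xE m]; last by rewrite e1 e2 ef eg xE.
  apply/funext => n; have := xm n; rewrite e1 e2 ef eg.
  by rewrite /shift mul1g.
apply/seteqP; split=> x.
  move=> [z zC <-]; rewrite /= -gX; exists (relabel snd z).
    by apply/XC => m; have := zC m; case: c2 => _ <- /not_orP[].
  apply/esym/eqc => m; have := zC m => /not_orP[/= + _].
  exact: contra_notP.
rewrite /= -{1}gX => -[u Xu gu]; exists (fun n => (x n, u n)) => //.
move=> m /= [|]; last by have /XC/(_ m) := Xu.
apply; move: m; apply/eqc; exact: esym gu.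
Qed.

Lemma image_SFT_sofic (S T : finType) (f : config M S -> config M T)
  (cf : code f) (X : subshift M S) : is_SFT X -> is_sofic (image_subshift cf X).
Proof. by move=> sX; apply/is_soficP; exists S, X, f. Qed.

(** Being an SFT is invariant under conjugacy: if the extensions [F] and [G] of
    the two conjugating maps are given, [X] consists of the points [x] such that
    [F x] is in [Y] and [G (F x) = x]. *)
Lemma conjugate_SFT (S T : finType) (X : subshift M S) (Y : subshift M T) :
    X !=set0 -> conjugate (subshift_space X) (subshift_space Y) ->
  is_SFT Y -> is_SFT X.
Proof.
move=> X0 [f [g [fK gK cf cg ef]]] [C clC YC].
have eg : equivariant g.
  by move=> m y; rewrite -{1}[y]gK -ef fK.
have Y0 : Y !=set0.
  by case: X0 => x Xx; exists (val (f (exist _ x (mem_set Xx)))); exact: subshift_valP.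
have [F cF fF] := block_map_extends (conj cf ef) X0.
have [G cG gG] := block_map_extends (conj cg eg) Y0.
have cI : code (id : config M S -> config M S) by split=> // x; exact: cvg_id.
exists ((F @^-1` C) `|` [set x | (G \o F) x 1%g <> x 1%g]).
  apply: clopenU; first by apply: preimage_clopen clC _; case: cF.
  exact: coincidence_clopen (code_comp cF cG) cI.
have [_ eF] := cF; have [_ eG] := cG.
move=> x; split=> [Xx m [|]|xm].
- have /YC/(_ m) : subshift_set Y (F x); last by rewrite /= eF.
  by have := fF (exist _ x (mem_set Xx)) => /= <-; exact: subshift_valP.
- apply; pose z : X := exist _ x (mem_set Xx).
  by have := gG (f z); rewrite fK fF /= eF eG => <-.
have YF : subshift_set Y (F x).
  by apply/YC => n; have /not_orP[/= + _] := xm n; rewrite eF.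
have -> : x = G (F x).
  apply/funext => n; have /not_orP[/= _ /contrapT] := xm n.
  by rewrite eF eG /shift mul1g.
have := gG (exist _ (F x) (mem_set YF)) => /= <-; exact: subshift_valP.
Qed.

End Codes.

(** * Metrizability of closed images of zero-dimensional spaces *)

Section Metrizability.
Local Open Scope ring_scope.
Import numFieldNormedType.Exports.
Variable R : realType.

Section SeparatingFunctions.
Variables (X : topologicalType) (f : nat -> X -> R).
Hypothesis cX : compact [set: X].
Hypothesis cf : forall k, continuous (f k).
Hypothesis f01 : forall k x, 0 <= f k x <= 1.
Hypothesis fsep : forall x y, (forall k, f k x = f k y) -> x = y.

Let t k x y := `|f k x - f k y| / k.+1%:R.
Let d x y := sup (range (fun k => t k x y)).

Let t_ge0 k x y : 0 <= t k x y.
Proof. by rewrite divr_ge0. Qed.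

Let t_le k x y : t k x y <= k.+1%:R^-1.
Proof.
rewrite -[leRHS]mul1r ler_wpM2r // ?invr_ge0 // ler_norml.
have := f01 k x; have := f01 k y; lra.
Qed.

Let t_le1 k x y : t k x y <= 1.
Proof. by apply: le_trans (t_le k x y) _; rewrite invf_le1 // ler1n. Qed.

Let t_le_d k x y : t k x y <= d x y.
Proof.
apply: ub_le_sup; last by exists k.
by exists 1 => _ [j _ <-]; exact: t_le1.
Qed.

Let d_le x y c : (forall k, t k x y <= c) -> d x y <= c.
Proof.
move=> tc; apply: ge_sup; first by exists (t 0%N x y), 0%N.
by move=> _ [k _ <-].
Qed.

(** Points other than [x] keep away from [x], uniformly near each of them. *)
Let d_far x y : x <> y -> exists n, \forall z \near y, n.+1%:R^-1 <= d x z.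
Proof.
move=> xy; have [k fk] : exists k, f k x != f k y.
  apply: contrapT => /forallNP fxy; apply: xy; apply: fsep => k.
  by apply/eqP; apply: contrapT => /negP; exact: fxy.
pose D := `|f k x - f k y| / 2.
have D0 : 0 < D by rewrite divr_gt0 // normr_gt0 subr_eq0.
have Dk0 : 0 < D / k.+1%:R by rewrite divr_gt0.
have [n _ /(_ n (leqnn n)) /= nD] := near_infty_natSinv_lt (PosNum Dk0).
exists n; have : \forall z \near y, D < `|f k x - f k z|.
  have cfz : (fun z => `|f k x - f k z|) @ y --> `|f k x - f k y|.
    by apply: cvg_norm; apply: cvgB; [exact: cvg_cst | exact: cf].
  apply: (cvgr_gt _ cfz); rewrite /D ltr_pdivrMr // ltr_pMr ?ltr1n //.
  by rewrite normr_gt0 subr_eq0.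
apply: filterS => z Dz; apply: le_trans (ltW nD) (le_trans _ (t_le_d k x z)).
by rewrite ler_wpM2r // ?invr_ge0 // ltW.
Qed.

Let d_near x e : 0 < e -> \forall y \near x, d x y < e.
Proof.
move=> e0; have e20 : 0 < e / 2 by rewrite divr_gt0.
have [n _ /(_ n (leqnn n)) /= ne] := near_infty_natSinv_lt (PosNum e20).
have : \forall y \near x, forall k : 'I_n, `|f k x - f k y| < e / 2.
  apply: filter_forall => k; have := @cf k x.
  by move/cvgrPdist_lt => /(_ _ e20).
apply: filterS => y fy; apply: (@le_lt_trans _ _ (e / 2)); last first.
  by rewrite ltr_pdivrMr // ltr_pMr ?ltr1n.
apply: d_le => k; have [kn|nk] := ltnP k n.
  rewrite ler_pdivrMr //; apply: le_trans (ltW (fy (Ordinal kn))) _.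
  by rewrite ler_peMr ?ler1n // ltW.
apply: le_trans (t_le k x y) (le_trans _ (ltW ne)).
by rewrite lef_pV2 ?posrE // ler_nat ltnS.
Qed.

(** The metric is the supremum of [|f k x - f k y| / (k + 1)]. *)
Lemma separated_metrizable : metrizable R X.
Proof.
exists d; split.
- move=> x y; split=> [dxy|->].
    apply: fsep => k; apply/eqP; rewrite -subr_eq0 -normr_eq0.
    have := t_le_d k x y; rewrite dxy => tk.
    have /eqP : t k x y = 0 by apply/eqP; rewrite eq_le tk t_ge0.
    by rewrite mulf_eq0 invr_eq0 pnatr_eq0 orbF.
  apply/eqP; rewrite eq_le; apply/andP; split; last exact: (le_trans (t_ge0 0 y y) (t_le_d 0 y y)).
  by apply: d_le => k; rewrite /t subrr normr0 mul0r.
- move=> x y; have tC : (fun k => t k x y) = (fun k => t k y x).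
    by apply/funext => k; rewrite /t distrC.
  by rewrite /d tC.
- move=> x y z; apply: d_le => k.
  apply: le_trans (lerD (t_le_d k x y) (t_le_d k y z)).
  by rewrite /t -mulrDl ler_wpM2r ?invr_ge0 // ler_distD.
- move=> x; apply/seteqP; split=> U.
    move=> xU; have cK : compact (~` U°).
      apply: subclosed_compact cX _ => //.
      by apply: open_closedC; exact: open_interior.
    have /compact_near_coveringP/(_ _ \oo (fun n z => n.+1%:R^-1 <= d x z)) := cK.
    case=> [y Uy|N _ /(_ N (leqnn N)) /= dN].
      have [|n yn] := @d_far x y.
        by move=> xy; apply: Uy; rewrite -xy; exact: xU.
      exists ([set z | n.+1%:R^-1 <= d x z], [set m | (n <= m)%N]) => /=.
        by split=> //; exists n.
      case=> z m /= [dz nm]; apply: le_trans dz.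
      by rewrite lef_pV2 ?posrE // ler_nat ltnS.
    exists N.+1%:R^-1 => //= y dy; apply: interior_subset; apply: contrapT => Uy.
    by move: (dN y Uy); rewrite leNgt dy.
  by case=> e /= e0 eU; apply: filterS (d_near x e0).
Qed.

End SeparatingFunctions.

Lemma metrizable_hausdorff (X : topologicalType) : metrizable R X -> hausdorff_space X.
Proof.
move=> [d [d0 ds dt dn]] x y xy; apply/d0/eqP/negPn/negP => dxy.
have dge a b : 0 <= d a b.
  have := dt a b a; rewrite (d0 a a).2 // (ds b a); lra.
have e0 : 0 < d x y / 2 by rewrite divr_gt0 // lt_neqAle eq_sym dxy dge.
have nb z : nbhs z [set y0 | d z y0 < d x y / 2] by rewrite dn; exists (d x y / 2).
have [z [/= xz yz]] := xy _ _ (nb x) (nb y).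
have := dt x z y; rewrite (ds z y); lra.
Qed.

(** The image of a compact space by a closed map is metrizable when countably
    many clopen sets separate closed sets from their neighbourhoods. *)
Lemma closed_image_metrizable (X Q : topologicalType) (p : X -> Q) (A : nat -> set X) :
    compact [set: X] -> hausdorff_space X ->
    continuous p -> (forall q, exists x, p x = q) ->
    (forall K, closed K -> closed (p @` K)) ->
    (forall i, clopen (A i)) ->
    (forall K U, closed K -> open U -> K `<=` U -> exists i, K `<=` A i /\ A i `<=` U) ->
  metrizable R Q.
Proof.
move=> cX hX cp sp clp clA sepA.
have cQ : compact [set: Q].
  have <- : p @` setT = setT.
    by apply/seteqP; split=> // q _; have [x <-] := sp q; exists x.
  by apply: continuous_compact => //; apply: continuous_subspaceT.
have T1 (q : Q) : closed [set q].
  have [x <-] := sp q; rewrite -image_set1; apply: clp.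
  exact/accessible_closed_set1/hausdorff_accessible.
have pre K : closed K -> closed (p @^-1` K).
  by move=> cK; apply: preimage_closed => // x _; exact: cp.
have dis (K L : set Q) : closed K -> closed L -> K `&` L = set0 ->
    exists i, p @^-1` K `<=` A i /\ A i `<=` p @^-1` (~` L).
  move=> cK cL KL; apply: sepA; first exact: pre.
    by rewrite preimage_setC; exact: closed_openC (pre _ cL).
  move=> x Kx Lx; suff : (K `&` L) (p x) by rewrite KL.
  by split.
have nQ : normal_space Q.
  apply/(@normal_openP R) => K L cK cL KL; have [i [KA AL]] := dis _ _ cK cL KL.
  exists (~` (p @` (~` A i))), (~` (p @` A i)); split.
  - by apply: closed_openC; apply: clp; apply: open_closedC; case: (clA i).
  - by apply: closed_openC; apply: clp; case: (clA i).
  - by move=> q Kq [x nAx xq]; apply: nAx; apply: KA; rewrite /= xq.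
  - by move=> q Lq [x /AL Ax xq]; apply: Ax; rewrite /= xq.
  - apply/seteqP; split=> // q [nA]; have [x xq] := sp q.
    by apply; exists x => //; apply: contrapT => Ax; apply: nA; exists x.
(* The functions separate the images of those [A i] and [A j] that have disjoint
   images. *)
pose C i := p @` A i.
have cC i : closed (C i) by apply: clp; case: (clA i).
pose h (ij : nat * nat) : Q -> R := Urysohn (C ij.1) (C ij.2).
pose g k : Q -> R := if unpickle k is Some ij then h ij else fun=> 0.
apply: (@separated_metrizable Q g) => //.
- move=> k; rewrite /g; case: unpickle => [ij|q]; first exact: Urysohn_continuous.
  exact: cvg_cst.
- move=> k q; rewrite /g; case: unpickle => [ij|]; last by rewrite lexx ler01.
  have /(_ (h ij q)) := @Urysohn_range Q R (C ij.1) (C ij.2).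
  by rewrite /= in_itv /=; apply; exists q.
move=> q q' gq; apply: contrapT => qq'.
have [U [V [oU oV qU qV UV]]] : exists U V : set Q, [/\ open U, open V, [set q] `<=` U,
    [set q'] `<=` V & U `&` V = set0].
  apply: ((@normal_openP R Q).1 nQ) => //.
  by apply/seteqP; split=> // z [/= ->].
have nb z W : open W -> [set z] `<=` W -> exists i, C i z /\ C i `<=` W.
  move=> oW zW; have [||i [zA AW]] := dis [set z] (~` W) (T1 z).
  - exact: open_closedC.
  - by apply/seteqP; split=> // y [/= -> nW]; apply: nW; apply: zW.
  exists i; split; first by have [x xz] := sp z; exists x => //; apply: zA.
  by move=> _ [x /AW/= /contrapT ? <-].
have [i [Ci CU]] := nb _ _ oU qU; have [j [Cj CV]] := nb _ _ oV qV.
have us : uniform_separator (C i) (C j).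
  apply: ((@normal_separatorP R Q).1 nQ) => //.
  by apply/seteqP; split=> // z [/CU Uz /CV Vz]; rewrite -UV.
have := gq (pickle (i, j)); rewrite /g pickleK /h /=.
have -> : Urysohn (C i) (C j) q = 0 :> R.
  by apply: (@Urysohn_sub0 Q R _ _ us); exists q.
have -> : Urysohn (C i) (C j) q' = 1 :> R.
  by apply: (@Urysohn_sub1 Q R _ _ us); exists q'.
by move/esym/eqP; rewrite oner_eq0.
Qed.

End Metrizability.

(** * Quotient systems *)

Lemma fg_enumeration (M : monoidType) : finitely_generated M ->
  exists e : nat -> M, forall m, exists i, e i = m.
Proof.
move=> [k [g gM]].
exists (fun i => if unpickle i is Some w then (\prod_(i <- (w : seq 'I_k)) g i)%g else 1%g).
by move=> m; have [w ->] := gM m; exists (pickle w); rewrite pickleK.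
Qed.

Section Quotients.
Variables (M : monoidType) (S : finType).
Variables (Y : subshift M S) (Z : subshift M (S * S)%type).
Hypothesis E : quot_equiv Y Z.

Lemma quot_pi_continuous : continuous (quot_pi E).
Proof. exact: pi_continuous. Qed.

Lemma quot_pi_surj (q : quot_carrier E) : exists y, quot_pi E y = q.
Proof. by exists (repr q); exact: reprK. Qed.

Lemma quotient_compact : compact [set: quotient_space E].
Proof.
have <- : quot_pi E @` setT = setT.
  by apply/seteqP; split=> // q _; have [y <-] := quot_pi_surj q; exists y.
apply: continuous_compact; last exact: (@subshift_compact _ _ Y).
by apply: continuous_subspaceT; exact: quot_pi_continuous.
Qed.

(** The saturation of a closed set [K] is closed, being the second projection of
    the compact set of the pairs of [Z] with first component in [K]. *)
Lemma quot_pi_closed (K : set (subshift_space Y)) :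
  closed K -> closed (quot_pi E @` K).
Proof.
move=> cK; pose V : set (config M S) := val @` K.
have cV : closed V.
  apply: compact_closed; first exact: config_hausdorff.
  apply: continuous_compact.
    by apply: continuous_subspaceT; exact: subshift_val_continuous.
  exact: subclosed_compact cK (@subshift_compact _ _ Y) _.
have [c1 _] := relabel_code M (@fst S S); have [c2 _] := relabel_code M (@snd S S).
pose B : set (config M (S * S)%type) :=
  subshift_set Z `&` (relabel fst @^-1` V `&` relabel snd @^-1` subshift_set Y).
have cB : closed B.
  apply: closedI; first exact: subshift_closed.
  apply: closedI; apply: preimage_closed => //.
  exact: subshift_closed.
have cW : closed (relabel snd @` B).
  apply: compact_closed; first exact: config_hausdorff.
  apply: continuous_compact; last exact: closed_config_compact.
  exact: continuous_subspaceT.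
have satE (y : subshift_space Y) :
    (quot_pi E @` K) (quot_pi E y) <-> (relabel snd @` B) (val y).
  split=> [[x Kx /quot_piP/asboolP xy]|[z [Zz [[x Kx xz] _]] zy]].
    exists (config_pair (val x) (val y)) => //; split=> //.
    by split; [exists x | exact: subshift_valP].
  exists x => //; apply/quot_piP/asboolP.
  have zE : config_pair (relabel fst z) (relabel snd z) = z.
    by apply/funext => n; rewrite /config_pair /relabel; case: (z n).
  by rewrite xz -zy zE.
have oW : open (val @^-1` (~` (relabel snd @` B)) : set (subshift_space Y)).
  by exists (~` (relabel snd @` B)) => //; exact: closed_openC.
rewrite -openC.
change (open (quot_pi E @^-1` (~` (quot_pi E @` K)) : set (subshift_space Y))).
rewrite (_ : _ @^-1` _ = val @^-1` (~` (relabel snd @` B))) //.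
by apply/seteqP; split=> y nK /satE.
Qed.

End Quotients.

Section CountableMonoid.
Variables (R : realType) (M : monoidType) (e : nat -> M).
Hypothesis eM : forall m, exists i, e i = m.

(** The countably many clopen sets of a subshift, indexed by a code for a window
    and a list of patterns on that window; codes of nothing give the empty
    set. *)
Definition pattern_set (S : finType) (X : subshift M S) (k : nat) : set (subshift_space X) :=
  if unpickle k is Some (ws, P) then
    [set x | [seq (val x (e i) : S) | i <- (ws : seq nat)] \in (P : seq (seq S))]
  else set0.

Lemma pattern_set_clopen (S : finType) (X : subshift M S) k : clopen (@pattern_set S X k).
Proof.
rewrite /pattern_set; case: unpickle => [[ws P]|]; last exact: clopen0.
apply: (@preimage_clopen _ _ (val : subshift_space X -> config M S)
  [set x : config M S | [seq (x (e i) : S) | i <- ws] \in P]).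
  apply: (@window_clopen _ _ [seq e i | i <- ws]) => x y xy /=.
  rewrite (_ : [seq (x (e i) : S) | i <- ws] = [seq (y (e i) : S) | i <- ws]) //.
  by apply/eq_in_map => i iw; apply: xy; exact: map_f.
exact: subshift_val_continuous.
Qed.

Lemma pattern_set_separates (S : finType) (X : subshift M S)
    (K U : set (subshift_space X)) :
  closed K -> open U -> K `<=` U ->
  exists k, K `<=` pattern_set k /\ pattern_set k `<=` U.
Proof.
move=> cK oU KU; have [C [clC KC CU]] := subshift_separation cK oU KU.
have [F FC] := clopen_window clC; have [i iM] := choice eM.
pose ws := [seq i m | m <- F].
pose P : seq (seq S) := [seq u <- [seq tval t | t <- enum {: (size F).-tuple S}] |
  `[< exists2 x : config M S, C x & [seq (x m : S) | m <- F] = u >]].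
have wsE (x : config M S) : [seq (x (e i) : S) | i <- ws] = [seq (x m : S) | m <- F].
  by rewrite -map_comp; apply: eq_map => m; rewrite /= iM.
exists (pickle (ws, P)); rewrite /pattern_set pickleK; split=> x /=.
  move=> Kx; rewrite wsE mem_filter; apply/andP; split.
    by apply/asboolP; exists (val x) => //; exact: KC.
  have sF : size [seq (val x m : S) | m <- F] == size F by rewrite size_map.
  by apply/mapP; exists (Tuple sF) => //; rewrite mem_enum.
rewrite wsE mem_filter => /andP[/asboolP[y Cy yx] _].
apply: CU; apply: FC Cy => n nF.
by move/eq_in_map: yx; apply.
Qed.

Lemma subshift_metrizable (S : finType) (X : subshift M S) : metrizable R (subshift_space X).
Proof.
apply: (@closed_image_metrizable R (subshift_space X) _ id (@pattern_set S X)).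
- exact: subshift_compact.
- exact: subshift_hausdorff.
- by move=> x; exact: cvg_id.
- by move=> q; exists q.
- by move=> K; rewrite image_id.
- exact: pattern_set_clopen.
- exact: pattern_set_separates.
Qed.

Lemma quotient_metrizable (S : finType) (Y : subshift M S)
  (Z : subshift M (S * S)%type) (E : quot_equiv Y Z) : metrizable R (quotient_space E).
Proof.
apply: (@closed_image_metrizable R (subshift_space Y) _ (quot_pi E) (@pattern_set S Y)).
- exact: subshift_compact.
- exact: subshift_hausdorff.
- exact: quot_pi_continuous.
- exact: quot_pi_surj.
- exact: quot_pi_closed.
- exact: pattern_set_clopen.
- exact: pattern_set_separates.
Qed.

Definition subshift_dynsys (S : finType) (X : subshift M S) : dynsys R M :=
  DynSys (@subshift_compact _ _ X) (subshift_metrizable X).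

Definition quotient_dynsys (S : finType) (Y : subshift M S)
  (Z : subshift M (S * S)%type) (E : quot_equiv Y Z) : dynsys R M :=
  DynSys (@quotient_compact _ _ _ _ E) (quotient_metrizable E).

End CountableMonoid.

Section QuotientClasses.
Variables (R : realType) (M : monoidType).

(** The first isomorphism theorem for systems. *)
Lemma quotient_conjugate (S : finType) (Y : subshift M S) (Z : subshift M (S * S)%type)
    (E : quot_equiv Y Z) (X : mspace M) (h : subshift_space Y -> X) :
    hausdorff_space X -> continuous h -> equivariant h ->
    (forall x, exists y, h y = x) ->
    (forall y y', h y = h y' <-> quot_rel Z y y') ->
  conjugate X (quotient_space E).
Proof.
move=> hX ch eh sh kh.
have [s hs] := choice sh.
pose f (q : quotient_space E) := h (repr q).
have fpi y : f (quot_pi E y) = h y.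
  by apply/kh/(quot_piP E); exact: reprK.
have sK : cancel (quot_pi E \o s) f by move=> x; rewrite /= fpi hs.
have fK : cancel f (quot_pi E \o s).
  move=> q; have [y <-] := quot_pi_surj q; rewrite /= fpi.
  by apply/quot_piP/kh; rewrite hs.
have cf : continuous f.
  apply/(@quotient_continuous _ {eq_quot (quot_equiv_rel E)}).
  have -> // : f \o \pi_(quot_carrier E) = h.
  by apply/funext => y; exact: fpi.
exists (quot_pi E \o s), f; split=> //; last first.
  move=> m x; rewrite /= quot_act_pi; apply/quot_piP/kh.
  by rewrite hs (eh m) hs.
apply/continuous_closedP => A cA.
have -> : (quot_pi E \o s) @^-1` A = f @` A.
  apply/seteqP; split=> x; first by move=> Ax; exists ((quot_pi E \o s) x).
  by move=> [q Aq <-]; rewrite /preimage /= -[quot_pi _ _]/((quot_pi E \o s) (f q)) fK.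
apply: compact_closed => //; apply: continuous_compact.
  exact: continuous_subspaceT.
exact: subclosed_compact cA (@quotient_compact _ _ _ _ E) _.
Qed.

(** The action of a code on both coordinates. *)
Definition code_pair (S T : finType) (f : config M S -> config M T)
    (z : config M (S * S)%type) : config M (T * T)%type :=
  config_pair (f (relabel fst z)) (f (relabel snd z)).

Lemma code_pair_code (S T : finType) (f : config M S -> config M T) :
  code f -> code (code_pair f).
Proof.
move=> cf; have [c1 e1] := code_comp (relabel_code M (@fst S S)) cf.
have [c2 e2] := code_comp (relabel_code M (@snd S S)) cf.
split.
  apply: to_config_continuous => n [s t].
  have -> : [set x | code_pair f x n = (s, t)] =
     ((f \o relabel fst) @^-1` [set x | [set s] (x n)]) `&`
     ((f \o relabel snd) @^-1` [set x | [set t] (x n)]).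
    by apply/seteqP; split=> x /= => [[]|[]]; rewrite /code_pair /config_pair // => -> ->.
  apply: openI; apply: (@open_comp (config M (S * S)%type)) => [x _|].
  - exact: c1.
  - by case: (letter_clopen n [set s]).
  - exact: c2.
  - by case: (letter_clopen n [set t]).
move=> m x; apply/funext => n.
by have := e1 m x; have := e2 m x; rewrite /code_pair /config_pair /= => -> ->.
Qed.

Lemma quotient_pullback (S T : finType) (f : config M S -> config M T)
    (cf : code f) (X : subshift M S) (Y : subshift M T) (Z : subshift M (T * T)%type)
    (E : quot_equiv Y Z) (W : mspace M) :
    f @` X = Y -> hausdorff_space W -> conjugate W (quotient_space E) ->
  exists E' : quot_equiv X (preimage_subshift (code_pair_code cf) Z),
    conjugate W (quotient_space E').
Proof.
move=> fXY hW [u [v [uK vK cu cv eu]]].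
have fX (x : X) : f (val x) \in (Y : set (config M T)).
  by apply/mem_set; rewrite -fXY; exists (val x) => //; exact: subshift_valP.
pose F (x : subshift_space X) : subshift_space Y := exist _ (f (val x)) (fX x).
set Z' := preimage_subshift _ _.
have FZ x x' : quot_rel Z' x x' = quot_rel Z (F x) (F x') by [].
have E' : quot_equiv X Z'.
  case: (E) => Er Es Et; split=> [x|x y|y x z]; rewrite !FZ //.
  exact: Et.
exists E'.
have ev : equivariant v by move=> m q; rewrite -{1}[q]vK -eu uK.
apply: (@quotient_conjugate _ _ _ _ _ (v \o quot_pi E \o F)) => //.
- have cF : continuous F.
    apply: continuous_comp_initial => x.
    apply: (@continuous_comp _ _ _ set_val f); first exact: initial_continuous.
    by have [+ _] := cf; exact.
  move=> x; apply: continuous_comp; first exact: cF.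
  by apply: continuous_comp; [exact: quot_pi_continuous | exact: cv].
- move=> m x /=; rewrite -ev /= quot_act_pi; congr (v (quot_pi E _)).
  by apply: val_inj; have [_ ef] := cf; exact: ef.
- move=> w; have [y yw] := quot_pi_surj (u w).
  have := subshift_valP y; rewrite -{1}fXY => -[x Xx xy].
  exists (exist _ x (mem_set Xx)) => /=.
  have -> : F (exist _ x (mem_set Xx)) = y by exact: val_inj.
  by rewrite yw uK.
- move=> x y; rewrite FZ /=; split=> [/(can_inj vK)/quot_piP//|xy].
  by congr v; apply/quot_piP.
Qed.

(** The clopen set whose avoidance defines the diagonal. *)
Definition diagonal_letter (S : finType) : set (config M (S * S)%type) :=
  [set z | (z 1%g).1 <> (z 1%g).2].

Lemma diagonal_letter_clopen (S : finType) : clopen (@diagonal_letter S).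
Proof. exact: (letter_clopen 1%g [set st : S * S | st.1 <> st.2]). Qed.

Lemma subshift_is_quotient (S : finType) (Y : subshift M S) (W : mspace M) :
    hausdorff_space W -> conjugate W (subshift_space Y) ->
  exists E : quot_equiv Y (sft (diagonal_letter_clopen S)),
    conjugate W (quotient_space E).
Proof.
move=> hW [u [v [uK vK cu cv eu]]]; set D := sft _.
have DP (x y : Y) : quot_rel D x y <-> x = y.
  split=> [/asboolP xy|->].
    apply: val_inj; apply/funext => n; apply: contrapT => xyn.
    by apply: (xy n); rewrite /diagonal_letter /= /shift /config_pair /= mul1g.
  by apply/asboolP => m; rewrite /diagonal_letter /=.
have E : quot_equiv Y D.
  split=> [x|x y|y x z]; first exact/DP.
    by apply/idP/idP => /DP ->; exact/DP.
  by move=> /DP ->.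
exists E; apply: (@quotient_conjugate _ _ _ _ _ v) => //.
- by move=> m q; rewrite -{1}[q]vK -eu uK.
- by move=> w; exists (u w).
- by move=> x y; rewrite DP; split=> [/(can_inj vK)|->].
Qed.

Lemma systems_of_mono (C D : subshift_class M) : (forall S, C S `<=` D S) ->
  @subclass R M (systems_of R C) (systems_of R D).
Proof. by move=> CD X [S [Y [CY XY]]]; exists S, Y; split=> //; exact: CD. Qed.

Lemma quotient_systems_mono (C C' D D' : subshift_class M) :
    (forall S, C S `<=` C' S) -> (forall S, D S `<=` D' S) ->
  @subclass R M (quotient_systems R C D) (quotient_systems R C' D').
Proof.
move=> CC DD X [S [Y [Z [E [CY DZ XE]]]]]; exists S, Y, Z, E.
by split=> //; [exact: CC | exact: DD].
Qed.

Lemma SFT_sub_sofic (S : finType) : SFT M S `<=` sofic M S.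
Proof. by move=> Y; exact: SFT_sofic. Qed.

(** The numerator can be replaced by an SFT that covers it, provided the class of
    denominators is stable under pullback. *)
Lemma quotient_sofic_SFT (D : subshift_class M) :
    (forall (S T : finType) (f : config M S -> config M T) (cf : code f) Z,
      D T Z -> D S (preimage_subshift cf Z)) ->
  @subclass R M (quotient_systems R (sofic M) D) (quotient_systems R (SFT M) D).
Proof.
move=> Dpre X [S [Y [Z [E [/is_soficP[T [X' [f [sX' cf fX]]]] DZ XE]]]]].
have [E' XE'] := quotient_pullback cf fX (metrizable_hausdorff (@dynsys_metrizable _ _ X)) XE.
by exists T, X', _, E'; split=> //; exact: Dpre.
Qed.

Lemma sofic_quotient_SFT :
  @subclass R M (systems_of R (sofic M)) (quotient_systems R (sofic M) (SFT M)).
Proof.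
move=> X [S [Y [sY XY]]].
have [E XE] := subshift_is_quotient (metrizable_hausdorff (@dynsys_metrizable _ _ X)) XY.
by exists S, Y, _, E; split=> //; exact: sft_is_SFT.
Qed.

End QuotientClasses.

(** * An infinite ray *)

Section InfiniteRay.
Variables (M : monoidType) (k : nat) (g : 'I_k -> M).
Hypothesis gM : forall m : M, exists w : seq 'I_k, m = (\prod_(i <- w) g i)%g.
Hypothesis infM : infinite_set [set: M].

Let has_word (m : M) n := `[< exists2 w : seq 'I_k, size w = n & m = (\prod_(i <- w) g i)%g >].

Let has_word_ex m : exists n, has_word m n.
Proof. by have [w mw] := gM m; exists (size w); apply/asboolP; exists w. Qed.

(** Word length with respect to the generators. *)
Let len m := ex_minn (has_word_ex m).

Let len_word m : exists2 w : seq 'I_k, size w = len m & m = (\prod_(i <- w) g i)%g.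
Proof. by rewrite /len; case: ex_minnP => n /asboolP. Qed.

Let len_le (w : seq 'I_k) : (len (\prod_(i <- w) g i)%g <= size w)%N.
Proof. by rewrite /len; case: ex_minnP => n _; apply; apply/asboolP; exists w. Qed.

Let lenM a b : (len (a * b)%g <= len a + len b)%N.
Proof.
have [u <- {1}->] := len_word a; have [v <- {1}->] := len_word b.
by rewrite -size_cat -big_cat; exact: len_le.
Qed.

(** The elements [m] reached from [a] by left multiplications along a geodesic from
    [1] through [a]. *)
Let beyond a := [set m | exists2 h, m = (h * a)%g & len m = (len h + len a)%N].

Let beyond_step a : infinite_set (beyond a) ->
  exists i, infinite_set (beyond (g i * a)%g) /\ len (g i * a)%g = (len a).+1.
Proof.
move=> infa; apply: contrapT => /forallNP none; apply: infa.
pose T i := [set m | len (g i * a)%g = (len a).+1 /\ beyond (g i * a)%g m].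
have finT i : finite_set (T i).
  have [la|nla] := eqVneq (len (g i * a)%g) (len a).+1.
    apply: contrapT => iT; apply: (none i); split=> //; apply: contra_not iT.
    by apply: sub_finite_set => m [].
  have -> : T i = set0 by apply/seteqP; split=> // m [/eqP]; rewrite (negbTE nla).
  exact: finite_set0.
apply: (@sub_finite_set _ _ ([set a] `|` \bigcup_(i in [set: 'I_k]) T i)); last first.
  rewrite finite_setU; split; first exact: finite_set1.
  by apply: bigcup_finite => // i _; exact: finT.
move=> m [h -> lm]; have [w sw hw] := len_word h.
case/lastP: w sw hw => [|w i] sw hw.
  by left; rewrite /= hw big_nil mul1g.
right; exists i => //.
pose h' := (\prod_(j <- w) g j)%g.
have hE : h = (h' * g i)%g by rewrite hw -cats1 big_cat big_seq1.
have lh' : (len h' <= size w)%N by exact: len_le.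
have l1 : (len (g i * a)%g <= (len a).+1)%N.
  have := lenM (g i) a; have := len_le [:: i]; rewrite big_seq1 /=; lia.
move: lm; rewrite hE -mulgA => lm; have := lenM h' (g i * a)%g.
rewrite size_rcons hE in sw => l2.
have lE : len (g i * a)%g = (len a).+1.
  apply/eqP; rewrite eqn_leq l1 -(leq_add2l (size w)) addnS -addSn sw -lm.
  by apply: leq_trans l2 _; rewrite leq_add2r.
split=> //; exists h' => //; apply/eqP.
by rewrite eqn_leq l2 lm -sw lE addnS addSn ltnS leq_add2r.
Qed.

(** Koenig: an infinite finitely generated monoid has an infinite simple path
    of left multiplications by generators. *)
Lemma infinite_ray : exists (s : nat -> 'I_k) (c : nat -> M),
  [/\ c 0 = 1%g, forall n, c n.+1 = (g (s n) * c n)%g & injective c].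
Proof.
pose G := {a | infinite_set (beyond a)}.
have G1 : infinite_set (beyond 1%g).
  apply: contra_not infM; apply: sub_finite_set => m _.
  exists m; first by rewrite mulg1.
  have := len_le [::]; rewrite big_nil /=; lia.
have step (a : G) : exists i, infinite_set (beyond (g i * sval a)%g) /\
    len (g i * sval a)%g = (len (sval a)).+1 by exact: beyond_step (svalP a).
have [i iP] := choice step.
pose next (a : G) : G := exist _ (g (i a) * sval a)%g (iP a).1.
pose p n := iter n next (exist _ 1%g G1).
exists (i \o p), (sval \o p); split=> //.
have lp n : len (sval (p n)) = (n + len 1%g)%N.
  by elim: n => // n IH; rewrite /= (iP (p n)).2 IH.
by move=> n n' /= /(congr1 len); rewrite !lp; lia.
Qed.

End InfiniteRay.

(** * Products of topological spaces *)

Lemma prod_hausdorff (T U : topologicalType) :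
  hausdorff_space T -> hausdorff_space U -> hausdorff_space (T * U)%type.
Proof.
move=> hT hU [x y] [x' y'] xy; congr pair.
  apply: hT => A B xA xB.
  have [||[z t] [/= [Az _] [Bz _]]] := xy (A `*` setT) (B `*` setT).
  - by exists (A, setT) => //; split=> //; exact: filterT.
  - by exists (B, setT) => //; split=> //; exact: filterT.
  by exists z.
apply: hU => A B xA xB.
have [||[z t] [/= [_ Az] [_ Bz]]] := xy (setT `*` A) (setT `*` B).
- by exists (setT, A) => //; split=> //; exact: filterT.
- by exists (setT, B) => //; split=> //; exact: filterT.
by exists t.
Qed.

Lemma pair_map_continuous (T T' U U' : topologicalType) (f : T -> T') (g : U -> U') :
  continuous f -> continuous g -> continuous (fun xy : T * U => (f xy.1, g xy.2)).
Proof.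
move=> cf cg [x y]; apply: cvg_pair => /=.
  by apply: (@cvg_comp _ _ _ fst f); [exact: cvg_fst | exact: cf].
by apply: (@cvg_comp _ _ _ snd g); [exact: cvg_snd | exact: cg].
Qed.

(** * Expansiveness of quotients by SFTs *)

Section Expansive.
Variable M : monoidType.

(** The full shift, as the SFT that forbids nothing. *)
Definition full_shift (S : finType) : subshift M S := sft (@clopen0 (config M S)).

Lemma full_shiftP (S : finType) (x : config M S) : subshift_set (full_shift S) x.
Proof. by move=> m. Qed.

Definition to_full (S : finType) (x : config M S) : subshift_space (full_shift S) :=
  exist _ x (mem_set (@full_shiftP S x)).

Lemma to_full_continuous (S : finType) : continuous (@to_full S).
Proof. by apply: continuous_comp_initial => x; exact: cvg_id. Qed.

(** A quotient by an SFT [Z'] is expansive: there is a compact set [K'] of pairs of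
    points, disjoint from the diagonal, that every pair of distinct points visits
    under the action.  Pulled back to a full shift with a conjugate quotient,
    [K'] is separated from [Z] by a clopen set, and forbidding this clopen set
    defines [Z]. *)
Lemma conjugate_quotient_SFT (S T : finType) (Z : subshift M (S * S)%type)
    (E : quot_equiv (full_shift S) Z) (Y' : subshift M T)
    (Z' : subshift M (T * T)%type) (E' : quot_equiv Y' Z') :
    hausdorff_space (quotient_space E') ->
    conjugate (quotient_space E) (quotient_space E') -> is_SFT Z' -> is_SFT Z.
Proof.
move=> hQ' [f [f' [fK f'K cf _ ef]]] [C' [oC' cC'] Z'C].
pose Yp := (subshift_space Y' * subshift_space Y')%type.
pose B : set Yp := [set ab | C' (config_pair (val ab.1) (val ab.2))].
have cB : closed B.
  apply: (@preimage_closed _ _ (fun ab : Yp => config_pair (val ab.1) (val ab.2) : config M (T * T)%type) C') => // ab _.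
  apply: to_config_continuous => n [t t'].
  have -> : [set x : Yp | config_pair (val x.1) (val x.2) n = (t, t')] =
     ((fun x : Yp => val x.1) @^-1` [set x : config M T | [set t] (x n)]) `&`
     ((fun x : Yp => val x.2) @^-1` [set x : config M T | [set t'] (x n)]).
    by apply/seteqP; split=> x /= => [[]|[]]; rewrite /config_pair // => -> ->.
  apply: openI; apply: open_comp => [x _|].
  - apply: (@continuous_comp Yp (subshift_space Y') (config M T) fst val x); first exact: cvg_fst.
    exact: subshift_val_continuous.
  - by case: (letter_clopen n [set t]).
  - apply: (@continuous_comp Yp (subshift_space Y') (config M T) snd val x); first exact: cvg_snd.
    exact: subshift_val_continuous.
  - by case: (letter_clopen n [set t']).
pose Qp := (quotient_space E' * quotient_space E')%type.
pose K' : set Qp := (fun ab : Yp => (quot_pi E' ab.1, quot_pi E' ab.2) : Qp) @` B.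
have cK' : closed K'.
  apply: compact_closed; first exact: prod_hausdorff.
  apply: continuous_compact.
    apply: continuous_subspaceT.
    by apply: pair_map_continuous; exact: quot_pi_continuous.
  apply: (subclosed_compact cB (B := setT)) => //.
  have := compact_setX (@subshift_compact _ _ Y') (@subshift_compact _ _ Y').
  by rewrite setXTT.
pose F x := f (quot_pi E (to_full x)).
have cF : continuous F.
  move=> x; apply: (@continuous_comp _ _ _ (@to_full S) (f \o quot_pi E)).
    exact: to_full_continuous.
  by apply: continuous_comp; [exact: quot_pi_continuous | exact: cf].
have eF m x : F (shift m x) = mact m (F x).
  rewrite /F -ef /= quot_act_pi; congr (f (quot_pi E _)); exact: val_inj.
have FZ z : subshift_set Z z <-> F (relabel fst z) = F (relabel snd z).
  have zE : config_pair (relabel fst z) (relabel snd z) = z.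
    by apply/funext => n; rewrite /config_pair /relabel; case: (z n).
  split=> [Zz|/(can_inj fK)/quot_piP/asboolP]; last by rewrite /= zE.
  by congr f; apply/quot_piP/asboolP; rewrite /= zE.
pose G (z : config M (S * S)%type) : Qp := (F (relabel fst z), F (relabel snd z)).
have cK : closed (G @^-1` K').
  apply: preimage_closed => // z _.
  have [c1 _] := relabel_code M (@fst S S); have [c2 _] := relabel_code M (@snd S S).
  have A1 : continuous (F \o @relabel M _ _ (@fst S S)).
    by move=> y; apply: (@continuous_comp _ _ _ (relabel fst) F); [exact: c1 | exact: cF].
  have A2 : continuous (F \o @relabel M _ _ (@snd S S)).
    by move=> y; apply: (@continuous_comp _ _ _ (relabel snd) F); [exact: c2 | exact: cF].
  exact: cvg_pair (A1 z) (A2 z).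
have [||C [clC KC CZ]] := closed_open_clopen cK (U := ~` Z).
- exact/closed_openC/subshift_closed.
- move=> z [[a b] /= Bab [Fa Fb]] /FZ; rewrite -Fa -Fb => /quot_piP/asboolP.
  by move/Z'C/(_ 1%g); rewrite shift1.
exists C => // z; split=> [Zz m /CZ|zC]; first by apply; exact: subshift_shift.
apply/FZ; have [a Fa] := quot_pi_surj (F (relabel fst z)).
have [b Fb] := quot_pi_surj (F (relabel snd z)).
rewrite -Fa -Fb; apply/quot_piP/asboolP/Z'C => m Cm; apply: (zC m); apply: KC.
exists (subshift_act m a, subshift_act m b) => //=.
have Em : quot_pi E' (subshift_act m a) = F (relabel fst (shift m z)).
  by have := eF m (relabel fst z); rewrite -Fa /= quot_act_pi => <-.
have Em' : quot_pi E' (subshift_act m b) = F (relabel snd (shift m z)).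
  by have := eF m (relabel snd z); rewrite -Fb /= quot_act_pi => <-.
by rewrite Em Em'.
Qed.

End Expansive.

(** * A sofic equivalence relation that is not an SFT *)

Section Linked.
Variables (M : monoidType) (k : nat) (g : 'I_k -> M).

(** A letter [(p, v, b)] consists of a pointer [p] or none, a visibility flag [v]
    and a bit [b].  A pointer [Some i] at the site [n] leads to [g i * n]. *)
Definition pletter : finType := (option 'I_k * bool * bool)%type.

(** The rule at [n]: the two letters have the same pointer and flag, [h] is constant
    along the pointer, and if [n] is visible then [h n] is the difference of the
    two bits. *)
Definition link_rule (z : config M (pletter * pletter)%type) (h : M -> bool) n : Prop :=
  [/\ (z n).1.1 = (z n).2.1,
      forall i, (z n).1.1.1 = Some i -> h n = h (g i * n)%g &
      (z n).1.1.2 -> h n = (z n).1.2 (+) (z n).2.2].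

Lemma link_rule_shift z h m :
  link_rule (shift m z) (fun n => h (n * m)%g) 1%g <-> link_rule z h m.
Proof.
by rewrite /link_rule /shift mul1g; split=> -[e hp hv]; split=> // i /hp; rewrite mulg1.
Qed.

(** Two configurations are linked when some [h] satisfies the rule everywhere. *)
Definition linked : set (config M (pletter * pletter)%type) :=
  [set z | exists h, forall n, link_rule z h n].

(** Pairs of letters together with a value of [h]. *)
Definition hidden : finType := (pletter * pletter * bool)%type.

Definition link_forbidden : set (config M hidden) :=
  [set y | ~ link_rule (relabel fst y) (relabel snd y) 1%g].

Lemma link_forbidden_clopen : clopen link_forbidden.
Proof.
apply: (@window_clopen _ _ (1%g :: [seq g i | i <- enum 'I_k])) => x y xy.
have x1 : x 1%g = y 1%g by apply: xy; rewrite inE eqxx.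
have xg i : x (g i) = y (g i).
  by apply: xy; rewrite inE map_f ?orbT // mem_enum.
apply: contra_not; rewrite /link_rule /relabel x1 => -[yp yh yv]; split=> // i.
by move=> /yh; rewrite !mulg1 xg.
Qed.

Definition hidden_sft : subshift M hidden := sft link_forbidden_clopen.

(** The relation of being linked; see [link_relationP]. *)
Definition link_relation : subshift M (pletter * pletter)%type :=
  image_subshift (relabel_code M (@fst (pletter * pletter)%type bool)) hidden_sft.

Lemma link_relationP z : subshift_set link_relation z <-> linked z.
Proof.
split=> [[y yP <-]|[h zh]].
  exists (relabel snd y) => n; apply/link_rule_shift.
  exact: contrapT (yP n).
exists (fun n => (z n, h n)) => // n; apply.
exact: (link_rule_shift z h n).2 (zh n).
Qed.

Lemma link_relation_sofic : is_sofic link_relation.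
Proof. exact: image_SFT_sofic (sft_is_SFT _). Qed.

Lemma link_relation_equiv : quot_equiv (full_shift M pletter) link_relation.
Proof.
split=> [x|x y|y x z].
- by apply/asboolP/link_relationP; exists (fun=> false) => n; split=> // _; rewrite /= addbb.
- suff sym (u v : full_shift M pletter) : quot_rel link_relation u v -> quot_rel link_relation v u.
    by apply/idP/idP; exact: sym.
  move=> /asboolP/link_relationP[h uv]; apply/asboolP/link_relationP; exists h => n.
  have [/= e hp hv] := uv n; rewrite /link_rule /= -e; split=> // /hv ->.
  by rewrite addbC.
move=> /asboolP/link_relationP[h xy] /asboolP/link_relationP[h' yz].
apply/asboolP/link_relationP; exists (fun n => h n (+) h' n) => n.
have [/= e hp hv] := xy n; have [/= e' hp' hv'] := yz n; rewrite -e in hp' hv'.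
split=> /=; first by rewrite e.
  by move=> i pi; rewrite (hp i pi) (hp' i pi).
by move=> v; rewrite (hv v) (hv' v) -addbA (addbA (val y n).2) addbb addFb.
Qed.

Section NotSFT.
Variables (s : nat -> 'I_k) (c : nat -> M).
Hypothesis cS : forall n, c n.+1 = (g (s n) * c n)%g.
Hypothesis cI : injective c.

(** The product of the [i] generators that lead from [c j] to [c (j + i)]. *)
Fixpoint ray_word j i : M :=
  if i is i'.+1 then (g (s (j + i')) * ray_word j i')%g else 1%g.

Lemma ray_wordM j i : (ray_word j i * c j)%g = c (j + i).
Proof.
elim: i => [|i IH]; first by rewrite addn0 mul1g.
by rewrite addnS cS -IH /= mulgA.
Qed.

Lemma ray_wordS j i : ray_word j i.+1 = (ray_word j.+1 i * g (s j))%g.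
Proof.
elim: i => [|i IH]; first by rewrite /= addn0 mulg1 mul1g.
by rewrite [LHS]/= -/(ray_word j i.+1) IH /= mulgA addSnnS.
Qed.

(** The pointers that draw the path from [c 0] to [c N]. *)
Definition ray_pointer N (n : M) : option 'I_k :=
  omap (fun j : 'I_N => s j) [pick j : 'I_N | n == c j].

Lemma ray_pointerE N j : (j < N)%N -> ray_pointer N (c j) = Some (s j).
Proof.
move=> jN; rewrite /ray_pointer; case: pickP => [i /eqP/cI ->//|/(_ (Ordinal jN))].
by rewrite eqxx.
Qed.

Lemma ray_pointerP N n i : ray_pointer N n = Some i ->
  exists j, [/\ (j < N)%N, n = c j & i = s j].
Proof.
by rewrite /ray_pointer; case: pickP => // j /eqP -> [<-]; exists j.
Qed.

(** The path from [c 0] to [c N] with visible ends; if [b] holds, the bit is set at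
    the far end. *)
Definition far_letter N b n : pletter :=
  (ray_pointer N n, (n == c 0) || (n == c N), b && (n == c N)).

Definition far_config N : config M (pletter * pletter)%type :=
  fun n => (far_letter N false n, far_letter N true n).

Lemma far_config_not_linked N : ~ linked (far_config N.+1).
Proof.
move=> [h hP].
have h0 : h (c 0) = false.
  have [_ _ /= ->] := hP (c 0); last by rewrite eqxx.
  by rewrite (inj_eq cI).
have hN : h (c N.+1) = true.
  by have [_ _ /= ->] := hP (c N.+1); rewrite eqxx ?orbT.
have hj j : (j <= N.+1)%N -> h (c j) = false.
  elim: j => [//|j IH] jN; have [_ /(_ (s j)) + _] := hP (c j).
  by rewrite /= ray_pointerE // -cS => <- //; apply: IH; exact: ltnW.
by rewrite hj in hN.
Qed.

Definition blank : (pletter * pletter)%type := ((None, false, false), (None, false, false)).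

(** Blanking a far configuration outside a window with at most [N] sites makes it
    linked, since no path from the beginning to the end of the ray is left. *)
Lemma far_config_blanked N (F : seq M) (m : M) : (size F <= N)%N ->
  linked (fun n => if n \in F then far_config N (n * m)%g else blank).
Proof.
move=> sF.
(* [h] holds at the sites from which the whole rest of the path, up to a site that
   [m] sends to [c N], stays in [F].  It does not hold over [c 0], as this would
   place [N + 1] distinct sites in [F]. *)
pose hp n j := [/\ (j <= N)%N, (n * m)%g = c j &
  forall i, (i <= N - j)%N -> (ray_word j i * n)%g \in F].
exists (fun n => `[< exists j, hp n j >]) => n.
rewrite /link_rule; have [nF|nF] := boolP (n \in F); last by split.
split=> //=.
  move=> i /ray_pointerP[j [jN nj ->]]; apply/asbool_equiv_eq; split.
    move=> [j' [j'N nj' jF]]; exists j.+1.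
    have jj : j' = j by apply: cI; rewrite -nj -nj'.
    subst j'; split=> //; first by rewrite -mulgA nj -cS.
    move=> i' i'N; rewrite mulgA -ray_wordS; apply: jF.
    by move: i'N jN; clear; lia.
  move=> [j' [j'N nj' jF]]; exists j.
  have jj : j' = j.+1 by apply: cI; rewrite cS -nj -nj' mulgA.
  subst j'; split=> //; first exact: ltnW.
  case=> [|i'] i'N; first by rewrite mul1g.
  rewrite ray_wordS -mulgA; apply: jF.
  by move: i'N jN; clear; lia.
move=> /orP[] /eqP nc; rewrite nc.
  (* If [N = 0], both ends of the path coincide. *)
  have [N0|N0] := eqVneq N 0.
    rewrite N0 eqxx; apply/asboolP; exists 0; split=> // i; rewrite N0 leqn0 => /eqP ->.
    by rewrite mul1g.
  rewrite (inj_eq cI) eq_sym (negbTE N0); apply/asboolPn => -[j [jN nj jF]].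
  have jj : j = 0 by apply: cI; rewrite -nj -nc.
  subst j; suff : (size [seq (ray_word 0 i * n)%g | i <- iota 0 N.+1] <= size F)%N.
    by rewrite size_map size_iota leqNgt ltnS sF.
  apply: uniq_leq_size.
    rewrite map_inj_uniq ?iota_uniq // => i i' /(congr1 (fun x => x * m)%g).
    by rewrite -!mulgA nc !ray_wordM => /cI.
  by move=> _ /mapP[i + ->]; rewrite mem_iota => iN; apply: jF; rewrite subn0.
rewrite eqxx; apply/asboolP; exists N; split=> // i.
by rewrite subnn leqn0 => /eqP ->; rewrite mul1g.
Qed.

Lemma link_relation_not_SFT : ~ is_SFT link_relation.
Proof.
move=> [C clC ZC]; have [F FC] := clopen_window clC; pose N := (size F).+1.
have : ~ subshift_set link_relation (far_config N).
  by move/link_relationP; exact: far_config_not_linked.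
apply; apply/ZC => m Cm.
have /link_relationP/ZC/(_ 1%g) := @far_config_blanked N F m (leqnSn _).
rewrite shift1; apply; apply: FC Cm => n nF.
by rewrite nF.
Qed.

End NotSFT.

End Linked.

(** * A quotient by an SFT that is not a subshift *)

Lemma code_window (M : monoidType) (S T : finType) (f : config M S -> config M T) n :
  code f -> exists F : seq M, forall x y, agree F x y -> f x n = f y n.
Proof.
move=> [cf _].
have sep t : exists F : seq M, forall x y, agree F x y -> f x n = t -> f y n = t.
  apply: clopen_window; apply: (@preimage_clopen _ _ f [set z : config M T | z n = t]) => //.
  exact: (letter_clopen n [set t]).
have [F FP] := choice sep.
exists (flatten [seq F t | t <- enum T]) => x y xy.
apply/esym/(FP (f x n) x y) => //; apply: agree_sub xy => m mF.
by apply/flatten_mapP; exists (f x n) => //; rewrite mem_enum.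
Qed.

Section Circle.
Local Open Scope ring_scope.
Variables (M : monoidType) (k : nat) (g : 'I_k -> M).

(** A letter is either blank or a pointer together with a binary digit; a pointer
    [i] at the site [n] leads to [g i * n]. *)
Definition digit : finType := option ('I_k * bool).

(** The rule at [n] asks for equal pointers.  In a solution, [c n] is the difference
    of the two binary numbers read from [n] on along the pointers; dropping their
    first digits doubles this difference, up to the difference of these digits.
    Blank sites stand for zero. *)
Definition carry_rule (z : config M (digit * digit)%type) (c : M -> int) n : Prop :=
  match (z n).1, (z n).2 with
  | Some (i, b), Some (j, b') => i = j /\ c n + c n = b%:Z - b'%:Z + c (g i * n)%g
  | None, None => c n = 0
  | _, _ => False
  end.

Definition digit_diff (a : digit * digit) : int :=
  if a is (Some (_, b), Some (_, b')) then b%:Z - b'%:Z else 0.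

(** The carry as a function of two consecutive pairs of digits: as its values lie
    in [-1, 0, 1], it is [1] (resp. [-1]) exactly when both differences of digits
    are. *)
Definition carry (z : config M (digit * digit)%type) n : int :=
  if (z n).1 is Some (i, _) then
    if digit_diff (z n) == digit_diff (z (g i * n)%g) then digit_diff (z n) else 0
  else 0.

Definition carry_forbidden : set (config M (digit * digit)%type) :=
  [set z | ~ carry_rule z (carry z) 1%g].

Lemma carry_forbidden_clopen : clopen carry_forbidden.
Proof.
pose E := enum 'I_k.
apply: (@window_clopen _ _
  (1%g :: [seq g i | i <- E] ++ [seq (g j * g i)%g | i <- E, j <- E])) => x y xy.
have x1 : x 1%g = y 1%g by apply: xy; rewrite inE eqxx.
have xg i : x (g i) = y (g i).
  by apply: xy; rewrite inE mem_cat map_f ?orbT // mem_enum.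
have xgg i j : x (g j * g i)%g = y (g j * g i)%g.
  apply: xy; rewrite inE mem_cat; apply/orP; right; apply/orP; right.
  by apply/allpairsP; exists (i, j); rewrite !mem_enum.
apply: contra_not; rewrite /carry_rule /carry x1.
case: (y 1%g) => [[[i b]|] [[j b']|]] //=.
by rewrite !mulg1 xg; case: (y (g i)) => [[[i' ?]|] ?] //=; rewrite xgg.
Qed.

(** Equality of the pointers, and equality modulo one of the binary numbers read
    along them; see [carry_relationP]. *)
Definition carry_relation : subshift M (digit * digit)%type := sft carry_forbidden_clopen.

Lemma carry_shift z n m : carry (shift m z) n = carry z (n * m)%g.
Proof. by rewrite /carry /shift; case: (z (n * m)%g).1 => [[i b]|] //; rewrite mulgA. Qed.

Lemma carry_rule_shift z c m :
  carry_rule (shift m z) (fun n => c (n * m)%g) 1%g <-> carry_rule z c m.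
Proof. by rewrite /carry_rule /shift !mul1g; case: (z m) => [[[i b]|] [[j b']|]] //=; rewrite mulg1. Qed.

Lemma carry_bound z n : -1 <= carry z n <= 1.
Proof.
rewrite /carry; case: (z n) => [[[i b]|] y] //=.
by case: ifP => // _; case: y => [[j b']|] //; case: b; case: b'.
Qed.

(** The rule makes carries grow as soon as they leave the interval [-1, 1], so that
    a bounded solution is the function [carry].  The bound [2] is what the
    transitivity of the relation requires. *)
Lemma carry_unique z c : (forall n, -2 <= c n <= 2) ->
  (forall n, carry_rule z c n) -> forall n, carry z n = c n.
Proof.
move=> cb cr; have c1 n : -1 <= c n <= 1.
  have := cr n; rewrite /carry_rule; case: (z n) => [[[i b]|] [[j b']|]] //=; last by lia.
  by move=> [_]; have := cb (g i * n)%g; case: b; case: b'; lia.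
move=> n; have := cr n; rewrite /carry_rule /carry.
case: (z n) => [[[i b]|] [[j b']|]] //= [_].
have := cr (g i * n)%g; have := c1 (g i * n)%g; have := c1 n; rewrite /carry_rule.
case: (z (g i * n)%g) => [[[i' a]|] [[j' a']|]] //=; last first.
  by case: b; case: b' => /=; lia.
move=> ? ? [_]; have := c1 (g i' * (g i * n))%g.
by case: b; case: b'; case: a; case: a' => /=; lia.
Qed.

Lemma carry_relationP z : subshift_set carry_relation z <->
  exists2 c : M -> int, forall n, -2 <= c n <= 2 & forall n, carry_rule z c n.
Proof.
have shE m : (fun n => carry z (n * m)%g) = carry (shift m z).
  by apply/funext => n; rewrite carry_shift.
split=> [zC|[c cb cr] m].
  exists (carry z) => n; first by have := carry_bound z n; lia.
  by apply/carry_rule_shift; rewrite shE; exact: contrapT (zC n).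
have cE : carry z = c by apply/funext => n; exact: carry_unique.
apply; rewrite -shE; apply/carry_rule_shift; rewrite cE; exact: cr.
Qed.

Lemma carry_relation_equiv : quot_equiv (full_shift M digit) carry_relation.
Proof.
split=> [x|x y|y x z].
- apply/asboolP/carry_relationP; exists (fun=> 0) => // n.
  by rewrite /carry_rule /=; case: (val x n) => [[i b]|] //; split=> //; lia.
- suff sym (u v : full_shift M digit) :
      quot_rel carry_relation u v -> quot_rel carry_relation v u.
    by apply/idP/idP; exact: sym.
  move=> /asboolP/carry_relationP[c cb cr]; apply/asboolP/carry_relationP.
  exists (fun n => - c n) => n; first by have := cb n; lia.
  have := cr n; rewrite /carry_rule /=.
  case: (val u n) => [[i b]|]; case: (val v n) => [[j b']|] //; last by lia.
  by move=> [-> e]; split=> //; lia.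
move=> /asboolP/carry_relationP[c cb cr] /asboolP/carry_relationP[c' cb' cr'].
have u1 n := carry_unique cb cr n; have u2 n := carry_unique cb' cr' n.
apply/asboolP/carry_relationP; exists (fun n => c n + c' n) => n.
  by rewrite -u1 -u2; set a := carry _ n; set b := carry _ n;
    have : -1 <= a <= 1 := carry_bound _ n; have : -1 <= b <= 1 := carry_bound _ n; lia.
have := cr n; have := cr' n; rewrite /carry_rule /=.
case: (val x n) => [[i b]|]; case: (val y n) => [[j b']|];
  case: (val z n) => [[l b'']|] //; last by lia.
by move=> [jl e'] [ij e]; subst l j; split=> //; lia.
Qed.

Section DigitRay.
Variables (s : nat -> 'I_k) (c : nat -> M).
Hypothesis cS : forall n, c n.+1 = (g (s n) * c n)%g.
Hypothesis cI : injective c.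

(** The [j] such that [n = c j], if any. *)
Definition ray_index (n : M) : option nat :=
  if pselect (exists j, c j = n) is left H then Some (projT1 (cid H)) else None.

Lemma ray_indexP n j : ray_index n = Some j <-> c j = n.
Proof.
rewrite /ray_index; case: pselect => [H|H]; last by split=> // e; case: H; exists j.
case: cid => i /= <-; split=> [[->]//|/cI ->//].
Qed.

(** The configuration carrying the binary sequence [u] along the ray. *)
Definition ray_config (u : nat -> bool) : config M digit :=
  fun n => omap (fun j => (s j, u j)) (ray_index n).

Lemma ray_rule u v (a : nat -> int) (b : M -> int) :
    (forall j, b (c j) = a j) ->
    (forall n, ray_index n = None -> b n = 0) ->
  (forall n, carry_rule (config_pair (ray_config u) (ray_config v)) b n) <->
  (forall j, a j + a j = (u j)%:Z - (v j)%:Z + a j.+1).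
Proof.
move=> ba b0; rewrite /carry_rule /config_pair /ray_config; split=> [br j|aj n].
  have := br (c j); rewrite (_ : ray_index (c j) = Some j); last exact/ray_indexP.
  by rewrite /= -cS !ba => -[].
case E: (ray_index n) => [j|] /=; last exact: b0.
by move/ray_indexP: E => <-; rewrite -cS !ba.
Qed.

(** [w0111...] and [w1000...], with [w] of length [q], are the two expansions of a
    dyadic number. *)
Lemma ray_config_dyadic (w : nat -> bool) q :
  subshift_set carry_relation (config_pair
    (ray_config (fun i => if i < q then w i else i != q)%N)
    (ray_config (fun i => if i < q then w i else i == q)%N)).
Proof.
apply/carry_relationP.
exists (fun n => if ray_index n is Some i then ((q < i)%N : nat)%:Z else 0).
  by move=> n; case: ray_index => // i; case: (q < i)%N.
apply/(@ray_rule _ _ (fun i => ((q < i)%N : nat)%:Z)).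
- by move=> j; rewrite (_ : ray_index (c j) = Some j) //; exact/ray_indexP.
- by move=> n ->.
move=> j; have [jq|jq|->] := ltngtP j q.
- by rewrite ltnNge jq /=; case: (w j).
- by rewrite ltnS (ltnW jq) /=; lia.
- by rewrite ltnS leqnn /=.
Qed.

Lemma ray_config_distinct :
  ~ subshift_set carry_relation (config_pair (ray_config (fun=> false))
      (ray_config (fun i => i == 0)%N)).
Proof.
move=> /carry_relationP[b bb br].
have b0 n : ray_index n = None -> b n = 0.
  by move=> nN; have := br n; rewrite /carry_rule /= /config_pair /ray_config nN.
have /(@ray_rule _ _ (b \o c)) H := br.
have {}H := H (fun _ => erefl) b0.
have := H 0%N; have := H 1%N; have := H 2%N; have := bb (c 3) => /=; lia.
Qed.

(** At a given site, [f] depends on the first [K] digits only.  By induction on [j] it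
    does not depend on the last [j] of them: sequences that first differ at the
    digit [q] can be moved to [w0111...] and [w1000...], which are identified. *)
Lemma ray_config_constant (T : finType) (f : config M digit -> config M T) :
    code f ->
    (forall x y, subshift_set carry_relation (config_pair x y) -> f x = f y) ->
  forall u v, f (ray_config u) = f (ray_config v).
Proof.
move=> cf fZ u v; apply/funext => n; have [F FP] := code_window n cf.
pose K := (\max_(m <- F) (odflt 0 (ray_index m)).+1)%N.
suff H j : forall u v, (forall i, i + j < K -> u i = v i)%N ->
    f (ray_config u) n = f (ray_config v) n.
  by apply: (H K) => i; rewrite ltnNge leq_addl.
elim: j => [|j IH] {u v} u v uv.
  apply: FP => m mF; rewrite /ray_config; case E: (ray_index m) => [i|] //=.
  rewrite uv // addn0 /K (big_rem m) //=; apply: leq_trans (leq_maxl _ _).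
  by rewrite E.
have [Kj|jK] := leqP K j.
  by apply: IH => i; rewrite ltnNge (leq_trans Kj) // leq_addl.
pose q := (K - j.+1)%N.
have [uvq|uvq] := eqVneq (u q) (v q).
  apply: IH => i ij; have [iq|iq] := ltnP i q; first by apply: uv; move: iq; rewrite /q; lia.
  by rewrite (_ : i = q) //; move: iq; rewrite /q; lia.
wlog uq : u v uv uvq / u q = false.
  case E: (u q); last by apply.
  move=> /(_ v u) <- //; first by move=> i /uv.
    by rewrite eq_sym.
  by move: uvq; rewrite E; case: (v q).
have vq : v q = true by move: uvq; rewrite uq; case: (v q).
have e1 : f (ray_config u) n = f (ray_config (fun i => if i < q then u i else i != q)%N) n.
  apply: IH => i ij; case: ltnP => // iq; have -> : i = q by move: iq; rewrite /q; lia.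
  by rewrite eqxx uq.
have e2 : f (ray_config v) n = f (ray_config (fun i => if i < q then u i else i == q)%N) n.
  apply: IH => i ij; case: ltnP => iq; first by rewrite uv //; move: iq; rewrite /q; lia.
  have -> : i = q by move: iq; rewrite /q; lia.
  by rewrite eqxx vq.
by rewrite e1 e2 (fZ _ _ (@ray_config_dyadic u q)).
Qed.

Lemma carry_quotient_not_subshift (T : finType) (U : subshift M T) :
  ~ conjugate (quotient_space carry_relation_equiv) (subshift_space U).
Proof.
move=> [f [f' [fK f'K cf _ ef]]].
pose h (y : subshift_space (full_shift M digit)) : subshift_space U :=
  f (quot_pi carry_relation_equiv y).
have bh : block_map h.
  split; last by move=> m y; rewrite /h -ef /= quot_act_pi.
  by move=> y; apply: continuous_comp; [exact: quot_pi_continuous | exact: cf].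
have Y0 : full_shift M digit !=set0.
  by exists (fun=> None); exact: full_shiftP.
have [G cG hG] := block_map_extends bh Y0.
have GZ x y : subshift_set carry_relation (config_pair x y) <-> G x = G y.
  have Ex (w : config M digit) : G w = val (h (to_full w)) by rewrite hG.
  rewrite !Ex; split=> [xy|/val_inj/(can_inj fK)/quot_piP/asboolP//].
  by congr (val (f _)); apply/quot_piP/asboolP.
apply: ray_config_distinct; apply/GZ; apply: ray_config_constant cG _ _ _.
by move=> x y /GZ.
Qed.

End DigitRay.
End Circle.

(** * The hierarchy of classes *)

Lemma conjugate_refl (M : monoidType) (X : mspace M) : conjugate X X.
Proof. by exists id, id; split=> // x; exact: cvg_id. Qed.

Theorem theorem1p4 (R : realType) (M : monoidType)
    (fgM : finitely_generated M) (infM : infinite_set [set: M]) :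
  [/\ proper_subclass (systems_of R (SFT M)) (systems_of R (sofic M)),
      proper_subclass (systems_of R (sofic M))
        (quotient_systems R (SFT M) (SFT M)),
      same_class (quotient_systems R (SFT M) (SFT M))
        (quotient_systems R (sofic M) (SFT M)),
      proper_subclass (quotient_systems R (sofic M) (SFT M))
        (quotient_systems R (SFT M) (sofic M)) &
      same_class (quotient_systems R (SFT M) (sofic M))
        (quotient_systems R (sofic M) (sofic M))].
Proof.
have [e eM] := fg_enumeration fgM; have [k [g gM]] := fgM.
have [s [c [_ cS cI]]] := infinite_ray gM infM.
have pullSFT : @subclass R M (quotient_systems R (sofic M) (SFT M))
    (quotient_systems R (SFT M) (SFT M)).
  by apply: quotient_sofic_SFT => S T f cf Z; exact: preimage_SFT.
have pullsofic : @subclass R M (quotient_systems R (sofic M) (sofic M))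
    (quotient_systems R (SFT M) (sofic M)).
  by apply: quotient_sofic_SFT => S T f cf Z; exact: preimage_sofic.
have SFTs S := @SFT_sub_sofic M S.
have notSFT := link_relation_not_SFT cS cI.
split; split.
- exact: systems_of_mono.
- move=> /(_ (subshift_dynsys R eM (link_relation g)))[].
    exists (pletter k * pletter k)%type, (link_relation g); split.
      exact: link_relation_sofic.
    exact: conjugate_refl.
  move=> S [Y [sY XY]]; apply: notSFT; apply: conjugate_SFT XY sY.
  have [Er _ _] := link_relation_equiv g.
  have /asboolP Zx := Er (to_full (fun=> (None, false, false))).
  by exists (config_pair (fun=> (None, false, false)) (fun=> (None, false, false))).
- by move=> X /sofic_quotient_SFT /pullSFT.
- move=> /(_ (quotient_dynsys R eM (carry_relation_equiv g)))[].
    exists (digit k), (full_shift M (digit k)), (carry_relation g).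
    exists (carry_relation_equiv g).
    by split; [exact: sft_is_SFT | exact: sft_is_SFT | exact: conjugate_refl].
  by move=> S [U [_ XU]]; exact: (carry_quotient_not_subshift cS cI XU).
- exact: quotient_systems_mono SFTs (fun _ _ => id).
- exact: pullSFT.
- by move=> X /pullSFT; exact: quotient_systems_mono (fun _ _ => id) SFTs _.
- move=> /(_ (quotient_dynsys R eM (link_relation_equiv g)))[].
    exists (pletter k), (full_shift M (pletter k)), (link_relation g).
    exists (link_relation_equiv g); split; [exact: sft_is_SFT | | exact: conjugate_refl].
    exact: link_relation_sofic.
  move=> S [Y [Z [E [_ sZ XE]]]]; apply: notSFT.
  apply: conjugate_quotient_SFT XE sZ.
  exact: metrizable_hausdorff (quotient_metrizable R eM E).
- exact: quotient_systems_mono SFTs (fun _ _ => id).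
- exact: pullsofic.
Qed.
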